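(* For a unital $C^*$-algebra $\mathcal A$ the following two statements are equivalent. (i) $\mathcal A$ is abelian. (ii) For every nonzero $\varphi\in\mathcal A^*_+$ the restriction of the norm topology to $[0,\varphi]$ is equal to $\tau_o[0,\varphi]$.
   Context: $\mathcal A^*_+$ is the cone of positive functionals on $\mathcal A$. Functionals are partially ordered by $\varphi\le\psi$ iff $\varphi(x)\le\psi(x)$ for all positive $x\in\mathcal A$, and $[0,\varphi]$ is the set of $\psi\in\mathcal A^*$ with $0\le\psi\le\varphi$. $\tau_o[0,\varphi]$ is the order topology of the poset $[0,\varphi]$. Order topology: let $(P,\le)$ be a poset. For a net, $x_\gamma\uparrow x$ (resp. $x_\gamma\downarrow x$) means that the net is increasing with supremum $x$ in $P$ (resp. decreasing with infimum $x$ in $P$). A net $(x_\gamma)_{\gamma\in\Gamma}$ in $P$ order converges to $x\in P$ if there are nets $(y_\gamma)_{\gamma\in\Gamma}$, $(z_\gamma)_{\gamma\in\Gamma}$ in $P$ with $y_\gamma\le x_\gamma\le z_\gamma$ for all $\gamma$, $y_\gamma\uparrow x$ and $z_\gamma\downarrow x$. A subset $X\subset P$ is order-closed if no net in $X$ order converges to a point outside $X$. The order topology $\tau_o(P)$ is the topology whose closed sets are exactly the order-closed sets. *)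

(* Defs.v *)
From HB Require Import structures.
From mathcomp Require Import all_boot all_order all_algebra.
From mathcomp Require Import complex.
From mathcomp Require Import all_classical reals topology normedtype.

Set Implicit Arguments.
Unset Strict Implicit.
Unset Printing Implicit Defensive.

Import Order.TTheory GRing.Theory Num.Theory.
Import numFieldNormedType.Exports.
Import ComplexField.Normc.

Local Open Scope classical_set_scope.
Local Open Scope ring_scope.
Local Open Scope complex_scope.

Section SetTypeOrder.
Context {d : Order.disp_t} {P : porderType d} (X : set P).

Let set_le (x y : X) : bool := (val x <= val y)%O.

Let set_lexx : reflexive set_le.
Proof. by move=> x; exact: lexx. Qed.

Let set_le_anti : antisymmetric set_le.
Proof. by move=> x y xy; apply/val_inj/le_anti. Qed.

Let set_le_trans : transitive set_le.
Proof. by move=> y x z; exact: le_trans. Qed.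

HB.instance Definition _ := Order.Le_isPOrder.Build d (set_type X)
  set_lexx set_le_anti set_le_trans.
End SetTypeOrder.

Section OrderTopology.
Local Open Scope order_scope.

(* Nets are families indexed by a directed preorder [le] on a type [I]. *)
Definition directed (I : Type) (le : I -> I -> Prop) : Prop :=
  [/\ inhabited I, forall i, le i i,
      forall i j k, le i j -> le j k -> le i k &
      forall i j, exists2 k, le i k & le j k].

Context {d : Order.disp_t} {P : porderType d}.

Definition net_up (I : Type) (le : I -> I -> Prop) (x : I -> P) (l : P) :=
  (forall i j, le i j -> x i <= x j) /\ supremums (range x) l.

Definition net_down (I : Type) (le : I -> I -> Prop) (x : I -> P) (l : P) :=
  (forall i j, le i j -> x j <= x i) /\ infimums (range x) l.

Definition order_cvg (I : Type) (le : I -> I -> Prop) (x : I -> P) (l : P) :=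
  exists y z : I -> P,
    [/\ forall i, y i <= x i <= z i, net_up le y l & net_down le z l].

Definition order_closed (X : set P) :=
  forall (I : Type) (le : I -> I -> Prop) (x : I -> P) (l : P),
    directed le -> (forall i, X (x i)) -> order_cvg le x l -> X l.

Definition order_open (U : set P) := order_closed (~` U).

Let sub_le (I : Type) (le : I -> I -> Prop) (J : set I) :
  {i | J i} -> {i | J i} -> Prop := fun i j => le (sval i) (sval j).

Let directed_sub (I : Type) (le : I -> I -> Prop) (J : set I) :
  directed le -> (forall i, exists2 j, J j & le i j) -> directed (@sub_le I le J).
Proof.
move=> [[i0] lexx letr ledir] cof; split.
- by have [j Jj _] := cof i0; constructor; exists j.
- by move=> [i Ji]; apply: lexx.
- by move=> [i Ji] [j Jj] [k Jk]; apply: letr.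
- move=> [i Ji] [j Jj]; have [k ik jk] := ledir i j.
  have [m Jm km] := cof k; exists (exist _ m Jm); rewrite /sub_le /=;
  exact: (letr _ k).
Qed.

Let order_cvg_sub (I : Type) (le : I -> I -> Prop) (J : set I) (x : I -> P) l :
  (forall i, exists2 j, J j & le i j) -> order_cvg le x l ->
  order_cvg (@sub_le I le J) (x \o sval) l.
Proof.
move=> cof [y [z [yxz [ymono [yub ylub]] [zmono [zlb zglb]]]]].
exists (y \o sval), (z \o sval); split=> [i | | ].
- exact: yxz.
- split=> [i j |]; first exact: ymono.
  split=> [_ [i _ <-] | u uub]; first by apply: yub; exists (sval i).
  apply: ylub => _ [i _ <-]; have [j Jj ij] := cof i.
  by apply: le_trans (ymono _ _ ij) _; apply: uub; exists (exist _ j Jj).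
- split=> [i j |]; first exact: zmono.
  split=> [_ [i _ <-] | u ulb]; first by apply: zlb; exists (sval i).
  apply: zglb => _ [i _ <-]; have [j Jj ij] := cof i.
  by apply: le_trans (zmono _ _ ij); apply: ulb; exists (exist _ j Jj).
Qed.

Lemma order_openT : order_open setT.
Proof. by move=> I le x l [[i0] _ _ _] nx _ _; exact: (nx i0). Qed.

Lemma order_openI : setI_closed order_open.
Proof.
move=> A B oA oB I le x l dirI xAB xl [Al Bl].
have [cof|ncof] := pselect (forall i, exists2 j, ~ A (x j) & le i j).
  apply: (oA _ _ _ _ (directed_sub dirI cof) _ (order_cvg_sub cof xl) Al).
  by case.
have [i0 hi0] : exists i0, forall j, le i0 j -> A (x j).
  apply: contrapT => h; apply: ncof => i; apply: contrapT => hi.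
  apply: h; exists i => j ij; apply: contrapT => nA; apply: hi.
  by exists j.
have cof : forall i, exists2 j, le i0 j & le i j.
  by case: dirI => _ _ _ ledir i; have [k ? ?] := ledir i0 i; exists k.
apply: (oB _ _ _ _ (directed_sub dirI cof) _ (order_cvg_sub cof xl) Bl).
by move=> [j ij] /= Bj; apply: (xAB j); split=> //; apply: hi0.
Qed.

Lemma order_open_bigU (K : Type) (f : K -> set P) :
  (forall k, order_open (f k)) -> order_open (\bigcup_k f k).
Proof.
move=> of_ I le x l dirI xf xl [k _ fkl].
by apply: (of_ k _ _ _ _ dirI _ xl fkl) => i fki; apply: (xf i); exists k.
Qed.

End OrderTopology.

(* [P] with the topology whose closed sets are the order-closed sets; this is
   not the library's order topology, which is generated by open intervals. *)
Definition order_topo_type {d : Order.disp_t} (P : porderType d) : Type := P.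

HB.instance Definition _ {d : Order.disp_t} (P : porderType d) :=
  Choice.on (order_topo_type P).
HB.instance Definition _ {d : Order.disp_t} (P : porderType d) :=
  isOpenTopological.Build (order_topo_type P)
    (@order_openT d P) (@order_openI d P) (@order_open_bigU d P).

Definition tau_o {d : Order.disp_t} (P : porderType d) : set_system P :=
  @open (order_topo_type P).
Arguments tau_o {d} P _.

Lemma tau_oE {d : Order.disp_t} (P : porderType d) :
  tau_o P = [set U : set P | order_closed (~` U)].
Proof. by []. Qed.

(* The ring operations are fields of the mixin because the hierarchy has no
   join of normed modules and (noncommutative) rings; the ring instance
   on the carrier is declared below. The zero algebra is allowed. *)
HB.mixin Record isCstarAlgebra (R : realType) A
    & CompleteNormedModule R[i] A := {
  cmul : A -> A -> A;
  cone : A;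
  star : A -> A;
  cmulA : associative cmul;
  cmul1x : left_id cone cmul;
  cmulx1 : right_id cone cmul;
  cmulDl : left_distributive cmul +%R;
  cmulDr : right_distributive cmul +%R;
  scale_cmull : forall (a : R[i]) (x y : A), a *: cmul x y = cmul (a *: x) y;
  scale_cmulr : forall (a : R[i]) (x y : A), a *: cmul x y = cmul x (a *: y);
  norm_cmul : forall x y : A, `|cmul x y| <= `|x| * `|y|;
  starK : involutive star;
  starD : {morph star : x y / x + y};
  starZ : forall (a : R[i]) (x : A), star (a *: x) = a^* *: star x;
  star_cmul : forall x y : A, star (cmul x y) = cmul (star y) (star x);
  norm_star_cmul : forall x : A, `|cmul (star x) x| = `|x| ^+ 2
}.

#[short(type="cstarAlgType")]
HB.structure Definition CstarAlgebra (R : realType) :=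
  {A of isCstarAlgebra R A & CompleteNormedModule R[i] A}.

HB.instance Definition _ (R : realType) (A : cstarAlgType R) :=
  GRing.Zmodule_isPzRing.Build (CstarAlgebra.sort A)
    cmulA cmul1x cmulx1 cmulDl cmulDr.

Section CstarTheory.
Context {R : realType} {A : cstarAlgType R}.

Lemma cstar_scalerAl (a : R[i]) (x y : A) : a *: (x * y) = a *: x * y.
Proof. exact: scale_cmull. Qed.

Lemma cstar_scalerAr (a : R[i]) (x y : A) : a *: (x * y) = x * (a *: y).
Proof. exact: scale_cmulr. Qed.

Lemma cstar_normM (x y : A) : `|x * y| <= `|x| * `|y|.
Proof. exact: norm_cmul. Qed.

Lemma starM (x y : A) : star (x * y) = star y * star x.
Proof. exact: star_cmul. Qed.

Lemma norm_starM (x : A) : `|star x * x| = `|x| ^+ 2.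
Proof. exact: norm_star_cmul. Qed.

Lemma star1 : star (1 : A) = 1.
Proof.
transitivity (star (star (1 : A) * 1)); last by rewrite mulr1 starK.
by rewrite starM starK mulr1.
Qed.

End CstarTheory.

(* The cone of elements of the form [y^* y]. *)
Definition positive (R : realType) (A : cstarAlgType R) (x : A) : Prop :=
  exists y : A, x = star y * y.

Section Dual.
Variables (R : realType) (A : cstarAlgType R).

Definition dual_pred : {pred A -> R[i]^o} :=
  fun f => `[< linear f /\ continuous f >].

Lemma dual_submod_closed : subsemimod_closed dual_pred.
Proof.
split; first split.
- apply/asboolP; split; last exact: cst_continuous.
  by move=> a x y; rewrite scaler0 addr0.
- move=> f g /asboolP[lf cf] /asboolP[lg cg]; apply/asboolP; split.
    move=> a x y; rewrite !fctE lf lg scalerDr.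
    by rewrite addrACA.
  by move=> x; apply: (@continuousD R[i] R[i]^o A f g x); [exact: cf|exact: cg].
- move=> b f /asboolP[lf cf]; apply/asboolP; split.
    move=> a x y; rewrite !fctE lf scalerDr !scalerA.
    by rewrite [b * a]mulrC.
  move=> x; apply: (@cvgZl_tmp R[i] R[i]^o A (nbhs x)); exact: cf.
Qed.
HB.instance Definition _ :=
  GRing.isSubmodClosed.Build R[i] (A -> R[i]^o) dual_pred dual_submod_closed.

(* [A^*]: the continuous linear functionals. *)
Record dual := Dual { dual_fun :> A -> R[i]^o; _ : dual_fun \in dual_pred }.
HB.instance Definition _ := [isSub for dual_fun].
HB.instance Definition _ := [Choice of dual by <:].
HB.instance Definition _ := [SubChoice_isSubLmodule of dual by <:].

Lemma dual_linear (f : dual) : linear f.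
Proof. by case: f => f /= /asboolP[]. Qed.
HB.instance Definition _ (f : dual) :=
  GRing.isLinear.Build R[i] A R[i]^o *:%R (dual_fun f) (dual_linear f).

Lemma dual_continuous (f : dual) : continuous f.
Proof. by case: f => f /= /asboolP[]. Qed.

Lemma dualP (f g : dual) : (forall x, f x = g x) -> f = g.
Proof. by move=> fg; apply: val_inj; apply/funext. Qed.

Lemma dualDE (f g : dual) x : (f + g) x = f x + g x.
Proof. by []. Qed.

Lemma dualZE a (f : dual) x : (a *: f) x = a * f x.
Proof. by []. Qed.

Lemma dual0E x : (0 : dual) x = 0.
Proof. by []. Qed.

Definition opnorm (f : dual) : R :=
  sup [set normc (f x) | x in [set x : A | `|x| <= 1]].

Let normCE (z : R[i]) : `|z| = (normc z)%:C.
Proof. by []. Qed.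

Let normc_ge0 (z : R[i]) : 0 <= normc z.
Proof. by have := normr_ge0 z; rewrite lecE => /andP[]. Qed.

Lemma opnorm_has_ubound (f : dual) :
  has_ubound [set normc (f x) | x in [set x : A | `|x| <= 1]].
Proof.
have /linear_bounded_continuous/bounded_funP/(_ 1)[M fM] := @dual_continuous f.
exists (complex.Re M) => _ [x /= x1 <-]; have := fM x x1.
by rewrite normCE lecE => /andP[_].
Qed.

Lemma le_opnorm (f : dual) (x : A) : `|x| <= 1 -> normc (f x) <= opnorm f.
Proof. by move=> x1; apply: (ub_le_sup (opnorm_has_ubound f)); exists x. Qed.

Lemma opnorm_le (f : dual) (M : R) :
  (forall x : A, `|x| <= 1 -> normc (f x) <= M) -> opnorm f <= M.
Proof.
move=> fM; apply: ge_sup; last by move=> _ [x /= x1 <-]; exact: fM.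
by exists (normc (f 0)), 0; rewrite //= normr0 ler01.
Qed.

Lemma opnorm_ge0 (f : dual) : 0 <= opnorm f.
Proof.
have := @le_opnorm f 0; rewrite normr0 linear0 normc0; exact.
Qed.

Lemma opnormD (f g : dual) : opnorm (f + g) <= opnorm f + opnorm g.
Proof.
apply: opnorm_le => x x1; rewrite dualDE (le_trans (le_normcD _ _))//.
by rewrite lerD// le_opnorm.
Qed.

Let opnormZ_le (l : R[i]) (f : dual) : opnorm (l *: f) <= normc l * opnorm f.
Proof.
apply: opnorm_le => x x1; rewrite dualZE normcM.
by apply: ler_wpM2l; [exact: normc_ge0|exact: le_opnorm].
Qed.

Lemma opnormZ (l : R[i]) (f : dual) : opnorm (l *: f) = normc l * opnorm f.
Proof.
have [->|l0] := eqVneq l 0.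
  rewrite normc0 mul0r scale0r; apply/eqP; rewrite eq_le opnorm_ge0 andbT.
  by apply: opnorm_le => x _; rewrite dual0E normc0.
have nl0 : normc l > 0.
  by rewrite lt_def normc_ge0 andbT; apply: contra l0 => /eqP/eq0_normc/eqP.
apply/eqP; rewrite eq_le opnormZ_le /= -ler_pdivlMl// -normcV.
by have := opnormZ_le l^-1 (l *: f); rewrite scalerK.
Qed.

Lemma opnorm_eq0 (f : dual) : opnorm f = 0 -> f = 0.
Proof.
move=> f0; apply: dualP => x; rewrite dual0E.
have [->|x0] := eqVneq x 0; first by rewrite linear0.
have nx0 : `|x| != 0 by rewrite normr_eq0.
have : normc (f (`|x|^-1 *: x)) <= 0.
  by rewrite -f0 le_opnorm// normrZ normfV normr_id mulVf.
rewrite le_eqVlt ltNge normc_ge0 orbF linearZ/=.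
move=> /eqP/eq0_normc/(congr1 ( *%R `|x|)).
by rewrite mulr0 /GRing.scale/= mulVKf.
Qed.

Let dual_norm (f : dual) : R[i] := (opnorm f)%:C.

Let dual_normD (f g : dual) : dual_norm (f + g) <= dual_norm f + dual_norm g.
Proof. by rewrite /dual_norm -rmorphD lecR opnormD. Qed.

Let dual_normZ (l : R[i]) (f : dual) : dual_norm (l *: f) = `|l| * dual_norm f.
Proof. by rewrite /dual_norm opnormZ rmorphM. Qed.

Let dual_norm0_eq0 (f : dual) : dual_norm f = 0 -> f = 0.
Proof. by case=> /opnorm_eq0. Qed.

HB.instance Definition _ :=
  Lmodule_isNormed.Build R[i] dual dual_normD dual_normZ dual_norm0_eq0.

(* [z <= w] in [R[i]] means that [w - z] is a nonnegative real. *)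
Definition dual_le (f g : dual) : bool :=
  `[< forall x : A, positive x -> (f x : R[i]) <= g x >].

Lemma dual_lexx : reflexive dual_le.
Proof. by move=> f; apply/asboolP. Qed.

Lemma dual_le_trans : transitive dual_le.
Proof.
move=> g f h /asboolP fg /asboolP gh; apply/asboolP => x px.
by rewrite (le_trans (fg x px)) ?gh.
Qed.

Let dual_starM_expand (f : dual) (c : R[i]) (x : A) :
  f (star (x + c *: (1 : A)) * (x + c *: (1 : A))) =
  f (star x * x) + c * f (star x) + c^* * f x + c^* * c * f 1.
Proof.
rewrite starD starZ star1 mulrDl !mulrDr -!cstar_scalerAl -!cstar_scalerAr.
by rewrite !mul1r !mulr1 !linearD/= !linearZ/= !addrA scalerA.
Qed.

Lemma dual_eq_positive (f g : dual) :
  (forall x, positive x -> f x = g x) -> f = g.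
Proof.
move=> fg; apply: dualP.
pose D := f - g; have DP y : D (star y * y) = 0.
  by rewrite -[LHS]/(f (star y * y) - g (star y * y)) fg ?subrr//; exists y.
suff D0 x : D x = 0 by move=> x; apply/eqP; rewrite -subr_eq0; apply/eqP/(D0 x).
have D1 : D 1 = 0 by rewrite -(DP 1) star1 mulr1.
have E c := dual_starM_expand D c x.
have {}E (c : R[i]) : c * D (star x) + c^* * D x = 0.
  by have := E c; rewrite !DP D1 mulr0 addr0 add0r => /esym.
have E1 : D (star x) + D x = 0 by have := E 1; rewrite rmorph1 !mul1r.
have /eqP := E 'i%R; rewrite conjCi mulNr -mulrBr mulf_eq0.
rewrite (negPf (neq0Ci _))/= subr_eq0 => /eqP e.
by move: E1; rewrite [X in X + _]e -mulr2n => /eqP; rewrite mulrn_eq0/= => /eqP.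
Qed.

Lemma dual_le_anti : antisymmetric dual_le.
Proof.
move=> f g /andP[/asboolP fg /asboolP gf]; apply: dual_eq_positive => x px.
by apply/eqP; rewrite eq_le [X in X && _]fg// [X in true && X]gf.
Qed.

HB.instance Definition _ := Order.Le_isPOrder.Build ring_display dual
  dual_lexx dual_le_anti dual_le_trans.

Definition order_interval (f : dual) : set dual := [set g | 0 <= g <= f].

Definition positive_functional (f : dual) : Prop :=
  forall x : A, positive x -> 0 <= (f x : R[i]).

End Dual.

(* Main.v *)
(** Order convergence of a net in [[0, f]] is norm convergence for every
    C*-algebra: a monotone net of positive functionals converges pointwise to its
    supremum or infimum, and the norm of a positive functional is controlled by
    its value at 1. So the order topology is always finer than the norm topology.

    If the algebra is commutative, any family of functionals with a common upper
    bound has a supremum (Riesz-Kantorovich). If [g_n -> g] in norm fast enough,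
    then [g + sup_{k >= n} (g_k - g)^+] decreases to [g]; hence [g_n] order
    converges to [g], and order-closed sets are norm closed.

    If it is not commutative, some pure state [p] is not multiplicative, so there
    is [b] with [p b = 0] and [p (b^* b) > 0]. The functionals
    [p_t = p ((1 + t b)^* . (1 + t b))] are pure, all lie below
    [2 (p + p (b^* . b))], and converge in norm to [p] as [t -> 0]; for small
    [t > 0] they are not multiples of [p], so 0 is the only positive functional
    below both [p] and [p_t]. Hence no net in [{p_t}] order converges to [p].

    Positivity in the algebra is handled without spectra: the square root of
    [1 - a], for [|a| <= 1], is the limit of an explicit iteration, and [h] is
    called positive when it is self-adjoint and [|l - h| <= l] for some
    [l >= 0]. *)
Require Import Defs.
From HB Require Import structures.
From mathcomp Require Import all_boot all_order all_algebra.
From mathcomp Require Import complex.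
From mathcomp Require Import all_classical reals topology normedtype.
From mathcomp Require Import ring lra.
Import Order.TTheory GRing.Theory Num.Theory.
Import numFieldNormedType.Exports.
Local Open Scope classical_set_scope.
Local Open Scope ring_scope.

Set Implicit Arguments.
Unset Strict Implicit.
Unset Printing Implicit Defensive.
Local Notation "r %:C" := (real_complex _ r) : ring_scope.
Local Notation "r **: x" := ((real_complex _ r) *: x) (at level 40) : ring_scope.

(** * Norm and involution *)

Section Norm.
Context {R : realType} {A : cstarAlgType R}.
Implicit Types (x y h k s : A) (r t c : R).

(** The norm is valued in [R[i]]; its real part makes estimates accessible to [lra] and [nra]. *)
Definition nrm (x : A) : R := complex.Re `|x|.

Lemma RCB r t : (r - t)%:C = r%:C - t%:C.
Proof. exact: rmorphB. Qed.
Lemma RCD r t : (r + t)%:C = r%:C + t%:C.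
Proof. exact: rmorphD. Qed.
Lemma RCM r t : (r * t)%:C = r%:C * t%:C.
Proof. exact: rmorphM. Qed.

Lemma ge0_ReK (z : R[i]) : 0 <= z -> z = (complex.Re z)%:C.
Proof. by move=> /ger0_Im; case: z => a b /= ->. Qed.

Lemma nrmE x : `|x| = (nrm x)%:C.
Proof. by apply: ge0_ReK; apply: normr_ge0. Qed.

Lemma nrm_ge0 x : 0 <= nrm x.
Proof. by rewrite -lecR -nrmE; apply: normr_ge0. Qed.

Lemma nrm0 : nrm 0 = 0.
Proof. by rewrite /nrm normr0. Qed.

Lemma nrm_eq0 x : nrm x = 0 -> x = 0.
Proof. by move=> x0; apply/eqP; rewrite -normr_eq0 nrmE x0. Qed.

Lemma nrm_le0 x : nrm x <= 0 -> x = 0.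
Proof. by move=> x0; apply: nrm_eq0; apply/eqP; rewrite eq_le x0 nrm_ge0. Qed.

Lemma nrmD x y : nrm (x + y) <= nrm x + nrm y.
Proof. by rewrite -lecR RCD -!nrmE; apply: ler_normD. Qed.

Lemma nrmN x : nrm (- x) = nrm x.
Proof. by rewrite /nrm normrN. Qed.

Lemma nrmB x y : nrm (x - y) <= nrm x + nrm y.
Proof. by rewrite -[nrm y]nrmN nrmD. Qed.

Lemma nrmBC x y : nrm (x - y) = nrm (y - x).
Proof. by rewrite -nrmN opprB. Qed.

Lemma nrm_distD z x y : nrm (x - y) <= nrm (x - z) + nrm (z - y).
Proof. by rewrite -(subrKA z) nrmD. Qed.

Lemma nrmM x y : nrm (x * y) <= nrm x * nrm y.
Proof. by rewrite -lecR RCM -!nrmE; apply: cstar_normM. Qed.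

Lemma nrmZ (a : R[i]) x : nrm (a *: x) = Normc.normc a * nrm x.
Proof.
have : `|a *: x| = (Normc.normc a * nrm x)%:C by rewrite normrZ nrmE RCM.
by rewrite nrmE => -[].
Qed.

Lemma normcR r : Normc.normc r%:C = `|r|.
Proof. by rewrite /= expr0n/= addr0 sqrtr_sqr. Qed.

Lemma normci : Normc.normc ('i%C : R[i]) = 1.
Proof. by rewrite /= expr0n/= add0r expr1n sqrtr1. Qed.

Lemma mulii : 'i%C * 'i%C = -1 :> R[i].
Proof.
by apply/eqP; rewrite eq_complex /= !(mul0r, mulr0, mulr1, subr0, add0r) oppr0 !eqxx.
Qed.

Lemma nrmRZ r x : nrm (r **: x) = `|r| * nrm x.
Proof. by rewrite nrmZ normcR. Qed.

Lemma nrm_starM x : nrm (star x * x) = nrm x ^+ 2.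
Proof.
have : `|star x * x| = (nrm x ^+ 2)%:C by rewrite Defs.norm_starM nrmE rmorphXn.
by rewrite nrmE => -[].
Qed.

(** The C*-identity gives [nrm y ^+ 2 <= nrm (star y) * nrm y]; cancel, and use this for both [x]
    and [star x]. *)
Lemma nrm_star x : nrm (star x) = nrm x.
Proof.
have le y : nrm y <= nrm (star y).
  have := nrmM (star y) y; rewrite nrm_starM expr2.
  have := nrm_ge0 y; rewrite le_eqVlt => /orP[/eqP <- _|y0].
    exact: nrm_ge0.
  by rewrite ler_pM2r.
by apply/eqP; rewrite eq_le le -{2}[x]starK le.
Qed.

(** Only an inequality, since in the zero algebra the norm of 1 is 0. *)
Lemma nrm1_le1 : nrm (1 : A) <= 1.
Proof.
have : nrm (1 : A) ^+ 2 = nrm (1 : A) by rewrite -nrm_starM mulr1 star1.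
have := nrm_ge0 (1 : A); nra.
Qed.

Lemma nrm_scalar c : 0 <= c -> nrm (c **: (1 : A)) <= c.
Proof.
by move=> c0; rewrite nrmRZ ger0_norm// -[leRHS]mulr1 ler_wpM2l ?nrm1_le1.
Qed.

Lemma star0 : star (0 : A) = 0.
Proof. by apply: (addrI (star (0 : A))); rewrite -starD !addr0. Qed.

Lemma starN x : star (- x) = - star x.
Proof. by apply: (addrI (star x)); rewrite -starD !subrr star0. Qed.

Lemma starB x y : star (x - y) = star x - star y.
Proof. by rewrite starD starN. Qed.

Lemma conjE (z : R[i]) : z^* = conjc z.
Proof. by []. Qed.

Lemma starRZ r x : star (r **: x) = r **: star x.
Proof. by rewrite starZ conjE /= oppr0. Qed.

Lemma starIZ x : star ('i%C *: x) = - ('i%C *: star x).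
Proof.
rewrite starZ conjE -scaleNr; congr (_ *: _).
by apply/eqP; rewrite eq_complex /= oppr0 !eqxx.
Qed.

Definition sa x := star x = x.

Lemma sa0 : sa 0. Proof. exact: star0. Qed.
Lemma sa1 : sa 1. Proof. exact: star1. Qed.
Lemma saD x y : sa x -> sa y -> sa (x + y).
Proof. by rewrite /sa starD => -> ->. Qed.
Lemma saN x : sa x -> sa (- x).
Proof. by rewrite /sa starN => ->. Qed.
Lemma saB x y : sa x -> sa y -> sa (x - y).
Proof. by move=> xs ys; apply: saD => //; apply: saN. Qed.
Lemma saZ r x : sa x -> sa (r **: x).
Proof. by rewrite /sa starRZ => ->. Qed.
Lemma sa_scalar r : sa (r **: (1 : A)).
Proof. exact: saZ sa1. Qed.
Lemma sa_starM x : sa (star x * x).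
Proof. by rewrite /sa starM starK. Qed.
Lemma saM x y : sa x -> sa y -> x * y = y * x -> sa (x * y).
Proof. by rewrite /sa starM => -> -> ->. Qed.
Lemma saX x n : sa x -> sa (x ^+ n).
Proof.
move=> xs; elim: n => [|n IH]; first exact: sa1.
by rewrite /sa exprS starM IH xs -exprSr exprS.
Qed.

Lemma nrm_sqr h : sa h -> nrm (h * h) = nrm h ^+ 2.
Proof. by move=> hs; rewrite -nrm_starM hs. Qed.

Lemma sqr_eq0 h : sa h -> h * h = 0 -> h = 0.
Proof.
move=> hs hh; apply: nrm_eq0; apply/eqP; rewrite -sqrf_eq0 -nrm_sqr// hh.
by rewrite nrm0.
Qed.

Lemma starM_eq0 x : star x * x = 0 -> x = 0.
Proof.
move=> xx; apply: nrm_eq0; apply/eqP; rewrite -sqrf_eq0 -nrm_starM xx.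
by rewrite nrm0.
Qed.

Lemma scalar_comm (a : R[i]) x : (a *: (1 : A)) * x = x * (a *: (1 : A)).
Proof. by rewrite -cstar_scalerAl -cstar_scalerAr mul1r mulr1. Qed.

Lemma scalarM (a : R[i]) x : (a *: (1 : A)) * x = a *: x.
Proof. by rewrite -cstar_scalerAl mul1r. Qed.

Lemma scalerRA r t x : r **: (t **: x) = (r * t) **: x.
Proof. by rewrite scalerA RCM. Qed.

Lemma scaleR1 x : 1 **: x = x.
Proof. exact: scale1r. Qed.

Lemma addrr_scale x : x + x = 2 **: x.
Proof. by rewrite (RCD 1 1) scalerDl scaleR1. Qed.

(** The real sequence [r] is nondecreasing and bounded, hence Cauchy, and its increments dominate
    those of [w]. *)
Lemma nrm_cauchy (w : nat -> A) (r : nat -> R) (M : R) :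
  (forall n, nrm (w n.+1 - w n) <= r n.+1 - r n) -> (forall n, r n <= M) ->
  exists l, forall e, 0 < e -> exists N, forall n, (N <= n)%N -> nrm (w n - l) < e.
Proof.
move=> wr rM.
have wrn n m : (n <= m)%N -> nrm (w m - w n) <= r m - r n.
  elim: m => [|m IH]; first by rewrite leqn0 => /eqP ->; rewrite !subrr nrm0.
  rewrite leq_eqVlt => /orP[/eqP ->|]; first by rewrite !subrr nrm0.
  rewrite ltnS => /IH {}IH; apply: le_trans (nrm_distD (w m) _ _) _.
  have := wr m; lra.
have rcauchy e : 0 < e -> exists N, forall n m, (N <= n)%N -> (n <= m)%N -> r m - r n < e.
  move=> e0; have rup : has_sup (range r).
    by split; [exists (r 0%N), 0%N|exists M => _ [n _ <-]].
  have [_ [N _ <-] rN] := sup_adherent e0 rup.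
  have rmono n m : (n <= m)%N -> r n <= r m.
    by move=> nm; rewrite -subr_ge0; apply: le_trans (wrn _ _ nm); exact: nrm_ge0.
  exists N => n m Nn nm; have rm : r m <= sup (range r).
    by apply: ub_le_sup; [case: rup|exists m].
  have := rmono _ _ Nn; lra.
have /cauchy_cvg/cvg_ex[l wl] : cauchy (w @ \oo).
  apply/cauchyP => e e0.
  have eE := ge0_ReK (ltW e0); rewrite eE ltcR in e0.
  have [N wN] := rcauchy _ e0.
  exists (w N); exists N => // m /= Nm; rewrite -ball_normE /= nrmE eE ltcR nrmBC.
  exact: le_lt_trans (wrn _ _ Nm) (wN _ _ (leqnn _) Nm).
exists l => e e0.
have /cvgrPdist_lt/(_ e%:C) := wl; rewrite ltcR => /(_ e0)[N _ wN].
by exists N => n Nn; have := wN n Nn; rewrite nrmE ltcR nrmBC.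
Qed.

Lemma nrm_approx0 x (K : R) :
  (forall e, 0 < e -> nrm x <= K * e) -> x = 0.
Proof.
move=> xe; apply: nrm_le0; apply/ler_addgt0Pr => e e0; rewrite add0r.
have K0 : 0 < `|K| + 1 by have := normr_ge0 K; lra.
apply: le_trans (xe _ (divr_gt0 e0 K0)) _.
rewrite mulrA ler_pdivrMr// mulrC ler_wpM2l ?ltW//.
have := ler_norm K; lra.
Qed.

End Norm.

(** * Square roots *)

Section SquareRoot.
Context {R : realType} {A : cstarAlgType R}.
Implicit Types (x y h k s : A) (r t c : R).

Lemma scale_halfD x : 2^-1 **: x + 2^-1 **: x = x.
Proof.
rewrite -scalerDl -RCD (_ : 2^-1 + 2^-1 = 1 :> R) ?scale1r//.
by field.
Qed.

(** A fixed point [l] of [w -> (a + w * w) / 2] satisfies [(1 - l) ^+ 2 = 1 - a]. The iteration from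
    0 is majorized by the same iteration [r] with [a] replaced by the number 1. Whatever commutes
    with [a] commutes with every iterate, hence with the limit. *)
Lemma sqrt_1B (a : A) : sa a -> nrm a <= 1 ->
  exists s, [/\ sa s, s * s = 1 - a, nrm (1 - s) <= 1 &
    forall b, b * a = a * b -> b * s = s * b].
Proof.
move=> as_ a1.
pose w n := iter n (fun w : A => 2^-1 **: (a + w * w)) 0.
pose r n := iter n (fun r : R => (1 + r ^+ 2) / 2) 0.
have wS n : w n.+1 = 2^-1 **: (a + w n * w n) by [].
have rS n : r n.+1 = (1 + r n ^+ 2) / 2 by [].
have r01 n : 0 <= r n <= 1.
  by elim: n => [|n /andP[r0 r1]]; [rewrite /r /=; lra|rewrite rS; nra].
have half x : nrm (2^-1 **: x) = nrm x / 2.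
  by rewrite nrmRZ ger0_norm ?invr_ge0 ?ler0n// mulrC.
have wr n : nrm (w n) <= r n.
  elim: n => [|n IH]; first by rewrite nrm0.
  rewrite wS rS half ler_wpM2r ?invr_ge0 ?ler0n//.
  have := nrmD a (w n * w n); have := nrmM (w n) (w n); have := nrm_ge0 (w n).
  nra.
have sqrB x y : x * x - y * y = x * (x - y) + (x - y) * y.
  by rewrite mulrBr mulrBl addrA subrK.
(* Both increments are half a difference of squares, so [sqrB] bounds the next one by
   [(r n.+1 - r n) * (r n.+1 + r n) / 2], which is the next increment of [r]. *)
have wrS n : nrm (w n.+1 - w n) <= r n.+1 - r n.
  elim: n => [|n IH].
    rewrite wS rS /w /r /= mul0r addr0 subr0 half expr0n/= addr0 subr0.
    by rewrite ler_wpM2r ?invr_ge0 ?ler0n.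
  rewrite [w n.+2]wS {2}[w n.+1]wS -scalerBr half opprD addrACA subrr add0r.
  rewrite [r n.+2]rS sqrB.
  have := nrmD (w n.+1 * (w n.+1 - w n)) ((w n.+1 - w n) * w n).
  have := nrmM (w n.+1) (w n.+1 - w n); have := nrmM (w n.+1 - w n) (w n).
  have : nrm (w n.+1 - w n) * (nrm (w n.+1) + nrm (w n)) <=
      (r n.+1 - r n) * (r n.+1 + r n).
    by apply: ler_pM; rewrite ?lerD ?addr_ge0 ?nrm_ge0.
  have := rS n; nra.
have w_le1 n : nrm (w n) <= 1 by apply: le_trans (wr n) _; case/andP: (r01 n).
have [l wl] := @nrm_cauchy _ _ w r 1 wrS (fun n => proj2 (andP (r01 n))).
have lE : l - 2^-1 **: (a + l * l) = 0.
  apply: (@nrm_approx0 _ _ _ (1 + 2^-1 * (1 + nrm l))) => e /wl[N wN].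
  apply: le_trans (nrm_distD (w N.+1) _ _) _.
  rewrite wS -scalerBr -wS half nrmBC opprD addrACA subrr add0r sqrB.
  have := wN _ (leqnSn N); have := wN _ (leqnn N); have := w_le1 N.
  have := nrmD (w N * (w N - l)) ((w N - l) * l).
  have := nrmM (w N) (w N - l); have := nrmM (w N - l) l.
  have := nrm_ge0 l; have := nrm_ge0 (w N); have := nrm_ge0 (w N - l).
  nra.
have l_sa : star l - l = 0.
  apply: (@nrm_approx0 _ _ _ 2) => e /wl[N /(_ _ (leqnn N)) wN].
  apply: le_trans (nrm_distD (w N) _ _) _.
  have wsa n : star (w n) = w n.
    elim: n => [|n IH]; first exact: star0.
    by rewrite wS starRZ starD starM IH as_.
  by rewrite -{1}wsa -starB nrm_star nrmBC; lra.
have l_comm b : b * a = a * b -> b * l - l * b = 0.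
  move=> ba; apply: (@nrm_approx0 _ _ _ (2 * nrm b)) => e /wl[N /(_ _ (leqnn N)) wN].
  have bw n : b * w n = w n * b.
    elim: n => [|n IH]; first by rewrite mulr0 mul0r.
    rewrite wS -cstar_scalerAr -cstar_scalerAl mulrDr mulrDl ba.
    by rewrite mulrA IH -!mulrA IH.
  have -> : b * l - l * b = (w N - l) * b - b * (w N - l).
    by rewrite mulrBl mulrBr bw opprB [RHS]addrC addrA subrK.
  have := nrmB ((w N - l) * b) (b * (w N - l)).
  have := nrmM (w N - l) b; have := nrmM b (w N - l); have := nrm_ge0 b.
  nra.
exists (1 - l); split.
- by apply: saB; [exact: sa1|apply/subr0_eq].
- have al : a + l * l = l + l.
    by rewrite {4 3}(subr0_eq lE) scale_halfD.
  have -> : a = l + l - l * l by rewrite -al addrK.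
  by rewrite mulrBl mul1r mulrBr mulr1 !opprB opprD addrACA [RHS]addrA.
- rewrite opprB addrCA subrr addr0; apply/ler_addgt0Pr => e /wl[N /(_ _ (leqnn N))].
  have := nrm_distD (w N) l 0; rewrite !subr0 nrmBC; have := w_le1 N; lra.
- by move=> b /l_comm/subr0_eq bl; rewrite mulrBr mulrBl mulr1 mul1r bl.
Qed.
End SquareRoot.

(** * Positive elements *)

Section PositiveCone.
Context {R : realType} {A : cstarAlgType R}.
Implicit Types (x y h k s : A) (r t c l : R).

(** In spectral terms, the spectrum lies in [[0, 2l]]. With this form stability under sums is the
    triangle inequality; agreement with [positive] is the harder fact [positiveP]. *)
Definition pos h := sa h /\ exists2 l, 0 <= l & nrm (l **: (1 : A) - h) <= l.

Lemma pos_sa h : pos h -> sa h. Proof. by case. Qed.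

Lemma pos_witness_le l l' h : l <= l' ->
  nrm (l **: (1 : A) - h) <= l -> nrm (l' **: (1 : A) - h) <= l'.
Proof.
move=> ll' hl.
have -> : l' **: (1 : A) - h = (l' - l) **: (1 : A) + (l **: (1 : A) - h).
  by rewrite RCB scalerBl addrA subrK.
apply: le_trans (nrmD _ _) _.
have : 0 <= l' - l by lra.
by move=> /(@nrm_scalar _ A); lra.
Qed.

Lemma posD h k : pos h -> pos k -> pos (h + k).
Proof.
move=> [hs [l l0 hl]] [ks [m m0 km]]; split; first exact: saD.
exists (l + m); first exact: addr_ge0.
rewrite RCD scalerDl opprD addrACA.
by apply: le_trans (nrmD _ _) _; apply: lerD.
Qed.

Lemma posZ t h : 0 <= t -> pos h -> pos (t **: h).
Proof.
move=> t0 [hs [l l0 hl]]; split; first exact: saZ.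
exists (t * l); first exact: mulr_ge0.
by rewrite RCM -scalerA -scalerBr nrmRZ ger0_norm// ler_wpM2l.
Qed.

Lemma pos_scalar t : 0 <= t -> pos (t **: (1 : A)).
Proof.
move=> t0; split; first exact: sa_scalar.
by exists t => //; rewrite subrr nrm0.
Qed.

Lemma pos1 : pos 1.
Proof. by rewrite -[1]scaleR1; apply: (pos_scalar ler01). Qed.

Lemma pos0 : pos 0.
Proof. by rewrite -[0](scale0r (1 : A)); apply: (pos_scalar (lexx 0)). Qed.

Lemma pos_nrmB h : sa h -> pos (nrm h **: (1 : A) - h).
Proof.
move=> hs; split; first by apply: saB => //; exact: sa_scalar.
by exists (nrm h); rewrite ?nrm_ge0// opprB addrC subrK.
Qed.

Lemma pos_nrmD h : sa h -> pos (nrm h **: (1 : A) + h).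
Proof. by move=> hs; rewrite -nrmN -[h in _ + h]opprK; apply/pos_nrmB/saN. Qed.

(** Enlarge the witness by 1 to make it invertible; then [1 - k / l] has norm at most 1, [sqrt_1B]
    yields a root of [k / l], and its bound on [1 - s] makes that root positive. *)
Lemma pos_sqrt k : pos k ->
  exists s, [/\ pos s, s * s = k & forall b, b * k = k * b -> b * s = s * b].
Proof.
move=> [ks [l' l'0 /(pos_witness_le (ler_wpDr ler01 (lexx l')))]].
set l := l' + 1 => kl; have l0 : 0 < l by rewrite /l; lra.
pose a := l^-1 **: (l **: (1 : A) - k).
have li0 : 0 <= l^-1 by rewrite invr_ge0 ltW.
have aE : a = 1 - l^-1 **: k.
  by rewrite /a scalerBr scalerRA mulVf ?gt_eqF// scaleR1.
have a_sa : sa a by apply/saZ/saB => //; exact: sa_scalar.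
have [|s [ss s2 s1 sc]] := sqrt_1B a_sa.
  by rewrite nrmRZ ger0_norm// ler_pdivrMl// mulr1.
exists (Num.sqrt l **: s); split.
- apply: posZ; first exact: sqrtr_ge0.
  by split=> //; exists 1 => //; rewrite scaleR1.
- rewrite -cstar_scalerAl -cstar_scalerAr scalerRA -expr2 sqr_sqrtr ?ltW//.
  by rewrite s2 aE opprB addrC subrK scalerRA divff ?gt_eqF// scaleR1.
- move=> b bk; rewrite -cstar_scalerAl -cstar_scalerAr; congr (_ *: _).
  apply: sc; rewrite aE mulrBr mulrBl mulr1 mul1r.
  by rewrite -cstar_scalerAr bk -cstar_scalerAl.
Qed.

(* [h + i s] is a scalar multiple of a unitary, and [h] is its real part. *)
Lemma nrm_le_circle h s c : sa h -> sa s -> h * s = s * h ->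
  h * h + s * s = c **: (1 : A) -> 0 <= c -> nrm h ^+ 2 <= c.
Proof.
move=> hs ss hsC hh c0; pose u := h + 'i%C *: s.
have su : star u = h - 'i%C *: s by rewrite starD starIZ hs ss.
have uu : star u * u = c **: (1 : A).
  rewrite su mulrBl !mulrDr -!cstar_scalerAl -!cstar_scalerAr scalerA mulii.
  by rewrite hsC scaleN1r opprB addrACA subrr addr0.
have u2 : nrm u ^+ 2 <= c by rewrite -nrm_starM uu nrm_scalar.
have h2 : 2 * nrm h = nrm (u + star u).
  rewrite su addrACA subrr addr0.
  by rewrite addrr_scale nrmRZ ger0_norm.
have := nrmD u (star u); rewrite nrm_star -h2; have := nrm_ge0 h; nra.
Qed.

(** Scale [h] to [k] of norm at most 1 and let [s] be a root of [1 - k * k]. Then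
    [s * s + k * k = 1], so [nrm s <= 1] by [nrm_le_circle], and 1 witnesses that [k * k] is
    positive. *)
Lemma pos_sqr h : sa h -> pos (h * h).
Proof.
move=> hs; pose m := nrm h + 1.
have m0 : 0 < m by rewrite /m; have := nrm_ge0 h; lra.
pose k := m^-1 **: h; have ks : sa k by exact: saZ.
have mV : 0 <= m^-1 by rewrite invr_ge0 ltW.
have k1 : nrm k <= 1.
  by rewrite nrmRZ ger0_norm// ler_pdivrMl// mulr1 /m; lra.
have kks : sa (k * k) by apply: saM.
have [|s [ss s2 _ sc]] := sqrt_1B kks.
  by rewrite nrm_sqr// expr_le1// nrm_ge0.
have -> : h * h = (m * m) **: (k * k).
  rewrite -cstar_scalerAl -cstar_scalerAr !scalerRA.
  by rewrite -mulrA -invfM divff ?scaleR1// mulf_neq0 ?gt_eqF.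
apply: posZ; first by rewrite mulr_ge0 ?ltW.
split=> //; exists 1 => //; rewrite scaleR1 -s2 nrm_sqr//.
apply: (@nrm_le_circle s k) => //; first by rewrite (sc k) // mulrA.
by rewrite s2 subrK scaleR1.
Qed.

(** The square roots of [k] and of [c - k] commute and their squares add up to [c], so
    [nrm_le_circle] applies. *)
Lemma pos_le_nrm k c : pos k -> pos (c **: (1 : A) - k) -> 0 <= c -> nrm k <= c.
Proof.
move=> /pos_sqrt[h [/pos_sa hs hh hc]] /pos_sqrt[s [/pos_sa ss s2 sc]] c0.
rewrite -hh nrm_sqr//; apply: (@nrm_le_circle h s) => //.
  by apply: sc; rewrite mulrBr mulrBl scalar_comm -hh mulrA.
by rewrite hh s2 addrC subrK.
Qed.

Lemma pos_anti k : pos k -> pos (- k) -> k = 0.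
Proof.
move=> k0 kN; apply: nrm_le0; apply: pos_le_nrm => //.
by rewrite scale0r add0r.
Qed.

Lemma nrm_exp2n h j : sa h -> nrm (h ^+ (2 ^ j)%N) = nrm h ^+ (2 ^ j)%N.
Proof.
move=> hs; elim: j => [|j IH]; first by rewrite !expr1.
by rewrite expnS mulnC !exprM expr2 nrm_sqr ?IH//; apply: saX.
Qed.

(** Exponential growth beats linear growth. Bernoulli's bound is only linear in the exponent, so it
    is squared. Exponents are powers of 2 because [nrm_exp2n] computes norms of those powers
    only. *)
Lemma le_of_pow_growth (q l M : R) : 0 <= q -> 0 < l ->
  (forall n, q ^+ (2 ^ n)%N <= l ^+ (2 ^ n)%N * (1 + (2 ^ n)%N%:R * M)) -> q <= l.
Proof.
move=> q0 l0 qM; rewrite leNgt; apply/negP => lq.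
pose d := q / l - 1; have d0 : 0 < d by rewrite subr_gt0 ltr_pdivlMr// mul1r.
have bernoulli n : 1 + n%:R * d <= (q / l) ^+ n.
  have -> : q / l = 1 + d by rewrite /d addrC subrK.
  elim: n => [|n IH]; first by rewrite mul0r addr0.
  rewrite exprS -natr1; have : 0 <= n%:R :> R by []. nra.
have pM n : (q / l) ^+ (2 ^ n)%N <= 1 + (2 ^ n)%N%:R * M.
  by rewrite expr_div_n ler_pdivrMr ?exprn_gt0// mulrC qM.
(* Chosen so that [2 * M < d ^+ 2 * 2 ^ n]: the quadratic term of the squared bound then exceeds the
   linear one. *)
pose n := Num.truncn (2 * M / (d * d)).
have nM : 2 * M < d * d * n.+1%:R.
  rewrite -ltr_pdivrMl ?mulr_gt0// mulrC; exact: truncnS_gt.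
have n2 : n.+1%:R <= (2 ^ n)%N%:R :> R by rewrite ler_nat ltn_expl.
have := pM n.+1; rewrite expnS mulnC exprM natrM.
have := bernoulli (2 ^ n)%N; have : 0 < (2 ^ n)%N%:R :> R by rewrite ltr0n expn_gt0.
move: n2 nM; set p := (q / l) ^+ (2 ^ n)%N; set v := (2 ^ n)%N%:R; set u := n.+1%:R.
move=> uv Mu v0 vp pv.
have vd : 0 < v * d by exact: mulr_gt0.
have vd0 : 0 <= 1 + v * d by lra.
have := ler_pM vd0 vd0 vp vp; rewrite -[p * p]expr2.
have : v * (2 * M) <= v * (d * d * v) by rewrite ler_wpM2l ?(ltW v0)//; nra.
lra.
Qed.

(** The sum is half the sum of the squares of the self-adjoint elements [x + star x] and
    [i (x - star x)]. *)
Lemma pos_sumM x : pos (star x * x + x * star x).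
Proof.
pose a := x + star x; pose b := 'i%C *: (x - star x).
have a_sa : sa a by rewrite /sa starD starK addrC.
have b_sa : sa b by rewrite /sa starIZ starB starK -scalerN opprB.
have -> : star x * x + x * star x = 2^-1 **: (a * a + b * b).
  rewrite -(scale_halfD (_ + x * star x)) -scalerDr; congr (_ *: _).
  rewrite -cstar_scalerAl -cstar_scalerAr scalerA mulii scaleN1r /a.
  have sqrD (y z : A) : (y + z) * (y + z) = (y * y + z * z) + (y * z + z * y).
    by rewrite mulrDl !mulrDr [z * y + _]addrC addrACA.
  rewrite sqrD sqrD !mulrN !mulNr opprK -opprD opprB.
  rewrite [X in _ = X + _]addrC [RHS]addrACA subrr addr0.
  by rewrite [star x * x + _]addrC.
by apply: posZ; [rewrite invr_ge0|apply: posD; exact: pos_sqr].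
Qed.

(** Replaces the fact that [star x * x] and [x * star x] have the same nonzero spectrum. The
    intertwining [T * x = x * S] bounds the norm of [T ^+ n] by [l ^+ n] times a linear factor, so
    [nrm T <= l] and [- (x * star x)] is positive too. By [pos_sumM], [star x * x] is then positive
    along with its opposite. *)
Lemma starM_npos x : pos (- (star x * x)) -> x = 0.
Proof.
move=> [_ [l' l'0 /(pos_witness_le (ler_wpDr ler01 (lexx l')))]].
set l := l' + 1 => xl; have l1 : 1 <= l by rewrite /l; lra.
pose S := l **: (1 : A) + star x * x; pose T := l **: (1 : A) + x * star x.
have TS : T * x = x * S by rewrite mulrDl mulrDr scalar_comm mulrA.
have TSn n : T ^+ n * x = x * S ^+ n.
  elim: n => [|n IH]; first by rewrite mul1r mulr1.
  by rewrite exprSr -mulrA TS mulrA IH exprSr mulrA.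
have Sn n : nrm (S ^+ n) <= l ^+ n.
  elim: n => [|n IH]; first exact: nrm1_le1.
  rewrite !exprS; apply: le_trans (nrmM _ _) _; apply: ler_pM; rewrite ?nrm_ge0//.
  by move: xl; rewrite opprK.
have Tsa : sa T.
  by apply: saD; [exact: sa_scalar|rewrite -{1}(starK x); exact: sa_starM].
have Tn n : nrm (T ^+ n) <= l ^+ n * (1 + n%:R * nrm x ^+ 2).
  elim: n => [|n IH]; first by rewrite mul0r addr0 mulr1 nrm1_le1.
  have ln1 : 1 <= l ^+ n by apply: exprn_ege1.
  have -> : T ^+ n.+1 = l **: T ^+ n + x * S ^+ n * star x.
    by rewrite exprSr -TSn mulrDr -scalar_comm scalarM mulrA.
  apply: le_trans (nrmD _ _) _; rewrite nrmRZ ger0_norm; last lra.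
  have := nrmM (x * S ^+ n) (star x); have := nrmM x (S ^+ n); rewrite nrm_star.
  have := Sn n; rewrite exprS -natr1; have := nrm_ge0 x; have := nrm_ge0 (S ^+ n).
  move: (nrm (S ^+ n)) (nrm (x * S ^+ n)) (nrm (x * S ^+ n * star x)) => u v z u0 x0 uln vle zle.
  have vle' : v <= nrm x * l ^+ n by apply: le_trans vle _; exact: ler_wpM2l.
  have zle' : z <= nrm x ^+ 2 * l ^+ n.
    by apply: le_trans zle _; rewrite expr2 mulrAC ler_wpM2r.
  have : nrm x ^+ 2 * l ^+ n <= nrm x ^+ 2 * (l * l ^+ n).
    by rewrite ler_wpM2l ?sqr_ge0// -[leLHS]mul1r ler_wpM2r//; lra.
  have : l * nrm (T ^+ n) <= l * (l ^+ n * (1 + n%:R * nrm x ^+ 2)).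
    by rewrite ler_wpM2l//; lra.
  move: zle'; lra.
have l0 : 0 < l by lra.
have Tl : nrm T <= l.
  apply: (@le_of_pow_growth _ _ (nrm x ^+ 2)) => // [|n]; first exact: nrm_ge0.
  by rewrite -nrm_exp2n//; exact: Tn.
have xxN : pos (- (x * star x)).
  split; last by exists l; [exact: ltW|rewrite opprK].
  by apply: saN; rewrite -{1}(starK x); exact: sa_starM.
have xxP : pos (star x * x).
  by have := posD (pos_sumM x) xxN; rewrite addrK.
apply: starM_eq0; apply: pos_anti => //; split; first by apply/saN/sa_starM.
by exists l; first exact: ltW.
Qed.

(** Here [d] is the absolute value of [k] and [m = d - k] is twice its negative part. Since
    [(d - k) * (d + k) = 0], [star (x * m) * (x * m) = - (m * d * m)] is the opposite of a square,
    so [x * m = 0] by [starM_npos]. This forces [m = 0], so [k = d] is a square. *)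
Lemma pos_starM x : pos (star x * x).
Proof.
set k := star x * x; have ks : sa k := sa_starM x.
have [d [/[dup] /pos_sa ds /pos_sqrt[t [/pos_sa ts tt tc]] dd dc]] := pos_sqrt (pos_sqr ks).
have dk : d * k = k * d by rewrite dc ?mulrA.
pose m := d - k; have ms : sa m by exact: saB.
have md : m * d = d * m by rewrite mulrBl mulrBr dk.
have mt : m * t = t * m by exact: tc.
have mk : m * k = - (m * d).
  by apply/eqP; rewrite -addr_eq0 -mulrDr mulrBl !mulrDr dd dk [k * k + _]addrC subrr.
have tm_sa : sa (t * m) by apply: saM.
have tmtm : t * m * (t * m) = m * d * m by rewrite -tt mulrA -mt !mulrA.
have xm0 : x * m = 0.
  apply: starM_npos; rewrite starM ms -mulrA (mulrA (star x)) -/k mulrA mk.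
  by rewrite mulNr opprK -tmtm; exact: pos_sqr.
have tm0 : t * m = 0.
  apply: sqr_eq0 => //; rewrite tmtm.
  by rewrite -[m * d]opprK -mk mulNr -mulrA /k -mulrA xm0 !mulr0 oppr0.
have dm0 : d * m = 0 by rewrite -tt -mulrA tm0 mulr0.
have : m * m = 0 by rewrite {2}/m mulrBr mk md dm0 oppr0 subr0.
move=> /(sqr_eq0 ms)/subr0_eq <-.
by rewrite -tt; exact: pos_sqr.
Qed.

Lemma positiveP x : positive x <-> pos x.
Proof.
split=> [[y ->]|/pos_sqrt[s [/pos_sa ss <- _]]]; first exact: pos_starM.
by exists s; rewrite ss.
Qed.

End PositiveCone.

(** * Extending functionals from the positive cone *)

Section Functionals.
Context {R : realType} {A : cstarAlgType R}.
Implicit Types (x y h k : A) (r t c : R) (f g : dual A).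

Definition re x : A := 2^-1 **: (x + star x).
Definition im x : A := 2^-1 **: ('i%C *: (star x - x)).

Lemma re_sa x : sa (re x).
Proof. by apply: saZ; rewrite /sa starD starK addrC. Qed.

Lemma im_sa x : sa (im x).
Proof. by apply: saZ; rewrite /sa starIZ starB starK -scalerN opprB. Qed.

Lemma scaleII x : 'i%C *: ('i%C *: x) = - x.
Proof. by rewrite scalerA mulii scaleN1r. Qed.

Lemma scaleIR r x : 'i%C *: (r **: x) = r **: ('i%C *: x).
Proof. by rewrite !scalerA mulrC. Qed.

Lemma reIm x : x = re x + 'i%C *: im x.
Proof.
by rewrite /re /im scaleIR scaleII opprB -scalerDr addrACA subrr addr0 scalerDr scale_halfD.
Qed.

Lemma re_comb h k : sa h -> sa k -> re (h + 'i%C *: k) = h.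
Proof.
move=> hs ks; rewrite /re starD starIZ hs ks addrACA subrr addr0.
by rewrite scalerDr scale_halfD.
Qed.

Lemma im_comb h k : sa h -> sa k -> im (h + 'i%C *: k) = k.
Proof.
move=> hs ks; rewrite /im starD starIZ hs ks opprD addrACA subrr add0r.
by rewrite -opprD -scalerDr scalerN !scaleII opprK scalerDr scale_halfD.
Qed.

Lemma re_id h : sa h -> re h = h.
Proof. by move=> hs; have := re_comb hs sa0; rewrite scaler0 addr0. Qed.

Lemma im_id h : sa h -> im h = 0.
Proof. by move=> hs; have := im_comb hs sa0; rewrite scaler0 addr0. Qed.

Lemma reD x y : re (x + y) = re x + re y.
Proof. by rewrite /re starD addrACA scalerDr. Qed.

Lemma imD x y : im (x + y) = im x + im y.
Proof. by rewrite /im starD opprD addrACA !scalerDr. Qed.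

Lemma reZ r x : re (r **: x) = r **: re x.
Proof. by rewrite /re starRZ -scalerDr !scalerRA mulrC. Qed.

Lemma nrm_re x : nrm (re x) <= nrm x.
Proof.
rewrite nrmRZ ger0_norm ?invr_ge0//.
by have := nrmD x (star x); rewrite nrm_star; lra.
Qed.

Lemma nrm_im x : nrm (im x) <= nrm x.
Proof.
rewrite nrmRZ ger0_norm ?invr_ge0// nrmZ normci mul1r.
by have := nrmB (star x) x; rewrite nrm_star; lra.
Qed.

Lemma complexRI (a : R[i]) : a = (complex.Re a)%:C + 'i%C * (complex.Im a)%:C.
Proof.
case: a => u v; apply/eqP; rewrite eq_complex /=.
by rewrite !(mul0r, mulr0, mul1r, subr0, addr0, add0r) !eqxx.
Qed.

Lemma scale_comb (a : R[i]) h k :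
  a *: (h + 'i%C *: k) = (complex.Re a **: h - complex.Im a **: k) +
    'i%C *: (complex.Re a **: k + complex.Im a **: h).
Proof.
rewrite {1}(complexRI a) scalerDl -[X in _ + X]scalerA !scalerDr -!scaleIR scaleII.
by rewrite [_ + - _]addrC [LHS]addrACA.
Qed.

Lemma dual_of_bounded (f : A -> R[i]^o) (C : R) : linear f ->
  (forall x, Normc.normc (f x) <= C * nrm x) -> exists g : dual A, forall x, g x = f x.
Proof.
move=> lf fC.
pose F : {linear A -> R[i]^o} := HB.pack f (GRing.isLinear.Build _ _ _ _ f lf).
have cf : continuous F.
  apply/linear_bounded_continuous/bounded_funP => r; exists (`|C|%:C * r) => x xr.
  have r0 : 0 <= r by apply: le_trans xr; exact: normr_ge0.
  apply: le_trans (_ : (`|C| * nrm x)%:C <= _).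
    rewrite (_ : `|F x| = (Normc.normc (f x))%:C)// lecR.
    apply: le_trans (fC x) _; apply: ler_wpM2r; [exact: nrm_ge0|exact: ler_norm].
  rewrite RCM -nrmE; apply: ler_wpM2l => //.
  by rewrite (_ : 0 = 0%:C)// lecR.
have fd : f \in @dual_pred R A by apply/asboolP; split.
by exists (@Dual R A f fd).
Qed.

(** One inequality for homogeneity suffices: applied to [t^-1] it gives the other. The extension [D]
    to self-adjoint elements does not depend on how they are written as differences of positive ones
    ([DE]) and is bounded by [e 1 * nrm h]; real and imaginary parts do the rest. *)
Lemma dual_of_pos (e : A -> R) :
  (forall h k, pos h -> pos k -> e (h + k) = e h + e k) ->
  (forall h, pos h -> 0 <= e h) ->
  (forall t h, 0 < t -> pos h -> t * e h <= e (t **: h)) ->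
  exists g : dual A, forall h, pos h -> g h = (e h)%:C.
Proof.
move=> eD e0 eZ.
have {}eZ t h : 0 <= t -> pos h -> e (t **: h) = t * e h.
  rewrite le_eqVlt => /orP[/eqP <- hp|t0 hp].
    by rewrite mul0r scale0r; have := eD _ _ pos0 pos0; rewrite addr0; lra.
  apply/eqP; rewrite eq_le eZ// andbT.
  have tV : 0 < t^-1 by rewrite invr_gt0.
  have := eZ _ _ tV (posZ (ltW t0) hp).
  by rewrite scalerRA mulVf ?gt_eqF// scaleR1 ler_pdivrMl.
pose D h := e (nrm h **: (1 : A) + h) - e (nrm h **: (1 : A)).
have DE p q : pos p -> pos q -> D (p - q) = e p - e q.
  move=> pp qp; have hs : sa (p - q) by apply: saB; [case: pp|case: qp].
  have n0 := nrm_ge0 (p - q).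
  have := eD _ _ (pos_nrmD hs) qp; rewrite addrA subrK.
  have := eD _ _ (pos_scalar n0) pp.
  by rewrite /D addrA; lra.
have saE h : sa h -> exists p q, [/\ pos p, pos q & h = p - q].
  move=> hs; exists (nrm h **: (1 : A) + h), (nrm h **: (1 : A)).
  split; [exact: pos_nrmD|exact/pos_scalar/nrm_ge0|].
  by rewrite addrC addKr.
have DD h k : sa h -> sa k -> D (h + k) = D h + D k.
  move=> /saE[p [q [pp qp ->]]] /saE[p' [q' [pp' qp' ->]]].
  rewrite addrACA -opprD !DE ?eD//; try exact: posD. lra.
have DZ r h : sa h -> D (r **: h) = r * D h.
  move=> /saE[p [q [pp qp ->]]]; have [r0|r0] := leP 0 r.
    rewrite scalerBr !DE ?eZ//; try exact: posZ. lra.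
  have r0' : 0 <= - r by lra.
  have -> : r **: (p - q) = (- r) **: q - (- r) **: p.
    rewrite -scalerBr -(opprB p q) scalerN -scaleNr; congr (_ *: _).
    by rewrite -rmorphN opprK.
  rewrite !DE ?eZ//; try exact: posZ. lra.
have Dn h : sa h -> `|D h| <= e 1 * nrm h.
  move=> hs; have n0 := nrm_ge0 h; have := e0 _ (pos_nrmB hs); have := e0 _ (pos_nrmD hs).
  have -> : D h = e (nrm h **: (1 : A)) - e (nrm h **: (1 : A) - h).
    rewrite -(DE _ _ (pos_scalar n0) (pos_nrmB hs)).
    by congr D; rewrite opprB addrC subrK.
  have := DE _ _ (pos_scalar n0) (pos_nrmB hs).
  rewrite opprB addrC subrK /D eZ//; last exact: pos1.
  by move=> ? ? ?; rewrite ler_norml; apply/andP; split; lra.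
pose G x : R[i]^o := (D (re x))%:C + 'i%C * (D (im x))%:C.
have lG : linear G.
  move=> a x y; rewrite /G reD imD {1 2}(reIm x) scale_comb -scaleNr -rmorphN.
  move: (re_sa x) (im_sa x) (re_sa y) (im_sa y).
  move: (re x) (im x) (re y) (im y) => h k h' k' hs ks hs' ks'.
  rewrite re_comb ?im_comb; try by [apply: saD; exact: saZ].
  rewrite !DD ?DZ//; try by [exact: saZ|apply: saD; exact: saZ].
  case: a => u v; apply/eqP; rewrite eq_complex /=; apply/andP.
  by split; apply/eqP; ring.
have GC x : Normc.normc (G x) <= 2 * e 1 * nrm x.
  apply: le_trans (le_normcD _ _) _; rewrite Normc.normcM normci mul1r !normcR.
  have := Dn _ (re_sa x); have := Dn _ (im_sa x).
  have := nrm_re x; have := nrm_im x; have := e0 _ pos1; nra.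
have [g gE] := dual_of_bounded lG GC; exists g => h hp.
have hs := pos_sa hp.
have e00 : e 0 = 0 by have := eD _ _ pos0 pos0; rewrite addr0; lra.
have D0 : D 0 = 0 by rewrite -(subrr 0) DE ?subrr//; exact: pos0.
have Dh : D h = e h by rewrite -[in LHS](subr0 h) DE ?e00 ?subr0//; exact: pos0.
by rewrite gE /G re_id// im_id// D0 Dh mulr0 addr0.
Qed.

End Functionals.

(** * Positive functionals *)

Section PositiveFunctionals.
Context {R : realType} {A : cstarAlgType R}.
Implicit Types (x y h k b : A) (r t c : R) (f g : dual A).

Definition rval f x : R := complex.Re (f x : R[i]).

Lemma dualB f x y : f (x - y) = f x - f y.
Proof. exact: linearB. Qed.
Lemma dualD f x y : f (x + y) = f x + f y.
Proof. exact: linearD. Qed.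
Lemma dualN f x : f (- x) = - f x.
Proof. exact: linearN. Qed.
Lemma dualZ f (a : R[i]) x : f (a *: x) = a * f x.
Proof. exact: linearZ. Qed.

Lemma rvalD f x y : rval f (x + y) = rval f x + rval f y.
Proof. by rewrite /rval dualD; case: (f x) (f y) => ? ? []. Qed.
Lemma rvalN f x : rval f (- x) = - rval f x.
Proof. by rewrite /rval dualN; case: (f x). Qed.
Lemma rvalB f x y : rval f (x - y) = rval f x - rval f y.
Proof. by rewrite rvalD rvalN. Qed.
Lemma rvalZ f r x : rval f (r **: x) = r * rval f x.
Proof. by rewrite /rval dualZ; case: (f x) => u v /=; rewrite mul0r subr0. Qed.
Lemma rval0 f : rval f 0 = 0.
Proof. by rewrite -(subrr 0) rvalB subrr. Qed.
Lemma rvalDf f g x : rval (f + g) x = rval f x + rval g x.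
Proof. by rewrite /rval dualDE; case: (f x) (g x) => ? ? []. Qed.
Lemma rvalNf f x : rval (- f) x = - rval f x.
Proof. by rewrite /rval -scaleN1r dualZE mulN1r; case: (f x). Qed.
Lemma rvalBf f g x : rval (f - g) x = rval f x - rval g x.
Proof. by rewrite rvalDf rvalNf. Qed.
Lemma rvalZf r f x : rval (r%:C *: f) x = r * rval f x.
Proof. by rewrite /rval dualZE; case: (f x) => u v /=; rewrite mul0r subr0. Qed.
Lemma rvalf0 x : rval (0 : dual A) x = 0.
Proof. by []. Qed.
Lemma rval_sum f m n (F : nat -> A) :
  rval f (\sum_(m <= i < n) F i) = \sum_(m <= i < n) rval f (F i).
Proof. exact: (big_morph _ (rvalD f) (rval0 f)). Qed.

Lemma dual_leP f g : reflect (forall k, pos k -> (f k : R[i]) <= g k) (f <= g).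
Proof. by apply: (iffP (asboolP _)) => fg k /positiveP; exact: fg. Qed.

Lemma dual_ge0P f : reflect (positive_functional f) (0 <= f).
Proof. exact: asboolP. Qed.

Lemma pos_rval f k : 0 <= f -> pos k -> f k = (rval f k)%:C.
Proof. by move=> /dual_leP f0 /f0; exact: ge0_ReK. Qed.

Lemma rval_ge0 f k : 0 <= f -> pos k -> 0 <= rval f k.
Proof. by move=> /dual_leP f0 /f0; rewrite lecE => /andP[]. Qed.

Lemma le_rval f g k : f <= g -> pos k -> rval f k <= rval g k.
Proof. by move=> /dual_leP fg /fg; rewrite lecE => /andP[]. Qed.

Lemma rval_leP f g : 0 <= f -> 0 <= g ->
  reflect (forall k, pos k -> rval f k <= rval g k) (f <= g).
Proof.
move=> f0 g0; apply: (iffP idP) => [fg k|fg]; first exact: le_rval.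
by apply/dual_leP => k kp; rewrite !pos_rval// lecR fg.
Qed.

Lemma rval_eq f g : 0 <= f -> 0 <= g ->
  (forall k, pos k -> rval f k = rval g k) -> f = g.
Proof.
move=> f0 g0 fg; apply/eqP; rewrite eq_le.
by apply/andP; split; apply/rval_leP => // k /fg ->.
Qed.

Lemma dual_le_subr f g : (0 <= g - f) = (f <= g).
Proof.
by apply/dual_leP/dual_leP => fg k /fg; rewrite -[(g - f) k]/(g k - f k) subr_ge0.
Qed.

Lemma dual_leD2 f g f' g' : f <= g -> f' <= g' -> f + f' <= g + g'.
Proof.
move=> /dual_leP fg /dual_leP fg'; apply/dual_leP => k kp.
by rewrite !dualDE; apply: lerD; [exact: fg|exact: fg'].
Qed.

Lemma dual_addr_ge0 f g : 0 <= f -> 0 <= g -> 0 <= f + g.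
Proof. by move=> f0 g0; rewrite -[0]addr0 dual_leD2. Qed.

Lemma dual_scale_ge0 r f : 0 <= r -> 0 <= f -> 0 <= r%:C *: f.
Proof.
move=> r0 /dual_leP f0; apply/dual_leP => k /f0 fk; rewrite dual0E dualZE.
by apply: mulr_ge0 => //; rewrite (_ : 0 = 0%:C)// lecR.
Qed.

Lemma sa_rval f h : 0 <= f -> sa h -> f h = (rval f h)%:C.
Proof.
move=> f0 hs; have -> : h = (nrm h **: (1 : A) + h) - nrm h **: (1 : A).
  by rewrite addrC addKr.
rewrite rvalB dualB !(pos_rval f0) ?RCB//; first exact/pos_scalar/nrm_ge0.
exact: pos_nrmD.
Qed.

Lemma rval_le_nrm f h : 0 <= f -> sa h -> `|rval f h| <= rval f 1 * nrm h.
Proof.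
move=> f0 hs; have := rval_ge0 f0 (pos_nrmD hs); have := rval_ge0 f0 (pos_nrmB hs).
by rewrite rvalB rvalD rvalZ ler_norml => ? ?; apply/andP; split; lra.
Qed.

Lemma dual_star f x : 0 <= f -> f (star x) = conjc (f x).
Proof.
move=> f0; rewrite (reIm x); move: (re x) (im x) (re_sa x) (im_sa x) => h k hs ks.
rewrite starD starIZ hs ks dualB dualD !dualZ (sa_rval f0 hs) (sa_rval f0 ks).
by apply/eqP; rewrite eq_complex /=; apply/andP; split; apply/eqP; ring.
Qed.

Lemma rval_re f x : 0 <= f -> rval f x = rval f (re x).
Proof.
move=> f0; rewrite {1}(reIm x) rvalD; move: (re x) (im x) (im_sa x) => h k ks.
by rewrite [X in _ + X]/rval dualZ (sa_rval f0 ks) /= mul0r mulr0 subr0 addr0.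
Qed.

Lemma dual_reIm f x : f x = f (re x) + 'i%C * f (im x).
Proof. by rewrite {1}(reIm x) dualD (dualZ f 'i%C (im x)). Qed.

(** The factor 2 comes from adding the bounds for [re x] and [im x]. It is not sharp, but any
    constant serves the convergence arguments. *)
Lemma normc_le_pos f x : 0 <= f -> Normc.normc (f x) <= 2 * rval f 1 * nrm x.
Proof.
move=> f0; have hs := re_sa x; have ks := im_sa x.
have := rval_le_nrm f0 hs; have := rval_le_nrm f0 ks.
have := nrm_re x; have := nrm_im x; rewrite dual_reIm.
move: (re x) (im x) hs ks => h k hs ks kx hx fk fh.
apply: le_trans (le_normcD _ _) _.
rewrite Normc.normcM normci mul1r (sa_rval f0 hs) (sa_rval f0 ks) !normcR.
by have := rval_ge0 f0 pos1; nra.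
Qed.

Lemma opnorm_le_pos f : 0 <= f -> opnorm f <= 2 * rval f 1.
Proof.
move=> f0; apply: opnorm_le => x; rewrite nrmE => x1.
have {}x1 : nrm x <= 1 by rewrite -lecR.
apply: le_trans (normc_le_pos x f0) _.
by have := rval_ge0 f0 pos1; nra.
Qed.

Lemma normc_le_opnorm f x : Normc.normc (f x) <= opnorm f * nrm x.
Proof.
have [/nrm_eq0 ->|x0] := eqVneq (nrm x) 0.
  by rewrite nrm0 mulr0 (_ : f 0 = 0) ?Normc.normc0//; exact: linear0.
have {}x0 : 0 < nrm x by rewrite lt_def x0 nrm_ge0.
have := @le_opnorm _ _ f ((nrm x)^-1 **: x).
rewrite nrmE (_ : 1 = 1%:C)// lecR nrmRZ dualZ Normc.normcM normcR.
rewrite ger0_norm ?invr_ge0 ?nrm_ge0// mulVf ?gt_eqF//.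
by rewrite ler_pdivrMl// [nrm x * _]mulrC; apply.
Qed.

Lemma rval_le_opnorm f x : rval f x <= opnorm f * nrm x.
Proof.
apply: le_trans (normc_le_opnorm f x); apply: le_trans (ler_norm _) _.
rewrite /rval; case: (f x) => u v /=; rewrite -sqrtr_sqr ler_wsqrtr// lerDl.
exact: sqr_ge0.
Qed.

Lemma opnormN f : opnorm (- f) = opnorm f.
Proof. by have [] := normrN f. Qed.

Lemma opnorm_distC f g : opnorm (f - g) = opnorm (g - f).
Proof. by rewrite -opnormN opprB. Qed.

Lemma pos_eq0 f : 0 <= f -> rval f 1 = 0 -> f = 0.
Proof.
move=> f0 f1; apply: opnorm_eq0; apply/eqP; rewrite eq_le opnorm_ge0 andbT.
by apply: le_trans (opnorm_le_pos f0) _; rewrite f1 mulr0.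
Qed.

(* Degenerate Cauchy-Schwarz: the null vectors of [f] form a left ideal. *)
Lemma pos_null_ideal f b y : 0 <= f -> f (star b * b) = 0 -> f (y * b) = 0.
Proof.
move=> f0 fb; case E: (f (y * b)) => [u v].
have fyb : f (star b * star y) = Complex u (- v) by rewrite -starM dual_star// E.
pose N := rval f (y * star y).
have quad n : 0 <= N - 2 * n * (u ^+ 2 + v ^+ 2).
  (* This is [- n] times the conjugate of [f (y * b)]. The term in [f (star b * b)] vanishes, so the
     expansion is affine in the real parameter [n] and stays nonnegative only if its slope is 0. *)
  pose c : R[i] := Complex (- n * u) (n * v).
  have := rval_ge0 f0 (pos_starM (c *: b + star y)).
  rewrite starD starK starZ mulrDl !mulrDr -!cstar_scalerAl -!cstar_scalerAr.
  rewrite {1}/rval !dualD !dualZ fb !mulr0 add0r E fyb /N /rval /=.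
  case: (f (y * star y)) => p q /=; lra.
have N0 : 0 <= N by have := quad 0; lra.
have uv0 : 0 <= u ^+ 2 + v ^+ 2 by rewrite addr_ge0 ?sqr_ge0.
have uv : u ^+ 2 + v ^+ 2 = 0.
  apply/eqP; rewrite eq_le uv0 andbT leNgt; apply/negP => uvp.
  have := quad ((N + 1) / (u ^+ 2 + v ^+ 2)).
  rewrite -mulrA divfK ?gt_eqF//; lra.
move/eqP: uv; rewrite paddr_eq0 ?sqr_ge0// !sqrf_eq0 => /andP[/eqP -> /eqP ->].
by [].
Qed.

End PositiveFunctionals.

(** * Order intervals *)

Section Interval.
Context {R : realType} {A : cstarAlgType R} (f : dual A).
Implicit Types (k : A) (g : dual A).

Local Notation itv := (set_type (order_interval f)).

Lemma itv_ge0 (g : itv) : 0 <= val g.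
Proof. by case: g => g /= /set_mem/andP[]. Qed.

Lemma itv_le (g : itv) : val g <= f.
Proof. by case: g => g /= /set_mem/andP[]. Qed.

Definition itv_of g (g0 : 0 <= g) (gf : g <= f) : itv :=
  exist _ g (mem_set (introT andP (conj g0 gf))).

Lemma itv_compl_subproof (g : itv) : (0 <= f - val g) && (f - val g <= f).
Proof.
rewrite dual_le_subr itv_le/= -dual_le_subr opprB addrC subrK; exact: itv_ge0.
Qed.

(** An order-reversing involution of the interval, which turns facts on decreasing nets into facts
    on increasing ones. *)
Definition itv_compl (g : itv) : itv := exist _ (f - val g) (mem_set (itv_compl_subproof g)).

Lemma itv_complK : involutive itv_compl.
Proof. by move=> g; apply: val_inj; rewrite /= opprB addrC subrK. Qed.

Lemma itv_compl_le (g h : itv) : (itv_compl g <= itv_compl h) = (h <= g).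
Proof.
rewrite -[LHS]/(f - val g <= f - val h) -[RHS]/(val h <= val g).
by rewrite -[LHS]dual_le_subr opprB addrC addrA subrK dual_le_subr.
Qed.

Lemma net_down_compl (I : Type) (le : I -> I -> Prop) (y : I -> itv) (l : itv) :
  net_up le y l -> net_down le (itv_compl \o y) (itv_compl l).
Proof.
move=> [ymono [yub ylub]]; split=> [i j ij|]; first by rewrite itv_compl_le ymono.
split=> [_ [i _ <-]|u ulb]; first by rewrite itv_compl_le; apply: yub; exists i.
rewrite -(itv_complK u) itv_compl_le; apply: ylub => _ [i _ <-].
by rewrite -itv_compl_le itv_complK; apply: ulb; exists i.
Qed.

Lemma net_up_compl (I : Type) (le : I -> I -> Prop) (y : I -> itv) (l : itv) :
  net_down le y l -> net_up le (itv_compl \o y) (itv_compl l).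
Proof.
move=> [ymono [yub ylub]]; split=> [i j ij|]; first by rewrite itv_compl_le ymono.
split=> [_ [i _ <-]|u ulb]; first by rewrite itv_compl_le; apply: yub; exists i.
rewrite -(itv_complK u) itv_compl_le; apply: ylub => _ [i _ <-].
by rewrite -itv_compl_le itv_complK; apply: ulb; exists i.
Qed.

(* The infimum of a decreasing net of positive functionals is its pointwise
   limit. *)
Lemma net_down_rval_cvg (I : Type) (le : I -> I -> Prop) (z : I -> itv) (l : itv) :
  directed le -> net_down le z l ->
  forall e, 0 < e -> exists i, rval (val (z i)) 1 - rval (val l) 1 < e.
Proof.
move=> [[i0] _ _ dir] [zmono [_ zglb]].
pose S k := range (fun i => rval (val (z i)) k); pose e k := inf (S k).
have zge0 i k : pos k -> 0 <= rval (val (z i)) k by apply/rval_ge0/itv_ge0.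
have Sinf k : pos k -> has_inf (S k).
  by move=> kp; split; [exists (rval (val (z i0)) k), i0|exists 0 => _ [i _ <-]; exact: zge0].
have e_le k i : pos k -> e k <= rval (val (z i)) k.
  by move=> kp; apply: ge_inf; [case: (Sinf k kp)|exists i].
have le_e k r : pos k -> (forall i, r <= rval (val (z i)) k) -> r <= e k.
  by move=> kp rz; apply: lb_le_inf; [case: (Sinf k kp)|move=> _ [i _ <-]].
have e_adh k d : pos k -> 0 < d -> exists i, rval (val (z i)) k < e k + d.
  by move=> kp d0; have [_ [i _ <-] ?] := inf_adherent d0 (Sinf k kp); exists i.
have e0 k : pos k -> 0 <= e k by move=> kp; apply: le_e => // i; exact: zge0.
have zmono_k i j k : le i j -> pos k -> rval (val (z j)) k <= rval (val (z i)) k.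
  by move=> ij; apply: le_rval; exact: (zmono _ _ ij).
(* Directedness provides one index at which the values at [h] and at [k] are both nearly minimal. *)
have eD h k : pos h -> pos k -> e (h + k) = e h + e k.
  move=> hp kp; have hkp := posD hp kp; apply/eqP; rewrite eq_le; apply/andP; split; last first.
    by apply: le_e => // i; rewrite rvalD lerD// e_le.
  apply/ler_addgt0Pr => d d0; have d2 : 0 < d / 2 by lra.
  have [i zi] := e_adh h _ hp d2; have [j zj] := e_adh k _ kp d2.
  have [m im jm] := dir i j; apply: le_trans (e_le _ m hkp) _; rewrite rvalD.
  by have := zmono_k _ _ h im hp; have := zmono_k _ _ k jm kp; lra.
have eZ t h : 0 < t -> pos h -> t * e h <= e (t **: h).
  move=> t0 hp; have thp := posZ (ltW t0) hp.
  by apply: le_e => // i; rewrite rvalZ ler_wpM2l ?e_le// ltW.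
have [g gE] := dual_of_pos eD e0 eZ.
have gr k : pos k -> rval g k = e k by move=> kp; rewrite /rval gE.
have g0 : 0 <= g.
  by apply/dual_leP => k kp; rewrite dual0E gE// (_ : 0 = 0%:C)// lecR e0.
have gz i : g <= val (z i).
  by apply/rval_leP => //; [exact: itv_ge0|move=> k kp; rewrite gr// e_le].
(* The pointwise infimum is itself a lower bound within the interval, hence below [l]. *)
have gl : itv_of g0 (le_trans (gz i0) (itv_le (z i0))) <= l.
  by apply: zglb => _ [i _ <-]; exact: gz.
move=> d d0; have [i zi] := e_adh 1 d pos1 d0; exists i.
have : rval g 1 <= rval (val l) 1 := le_rval gl pos1.
rewrite (gr _ pos1); lra.
Qed.

Lemma order_cvg_opnorm (I : Type) (le : I -> I -> Prop) (x : I -> itv) (l : itv) :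
  directed le -> order_cvg le x l ->
  forall e, 0 < e -> exists i, forall j, le i j -> opnorm (val (x j) - val l) < e.
Proof.
(* Write [x j - l = (x j - y j) - (l - y j)], a difference of positive functionals. Their values at
   1 are below [2 * e / 6] and [e / 6], and [opnorm_le_pos] doubles both, for a total of [e]. *)
move=> dirI [y [z [yxz yl zl]]] e e0; have e6 : 0 < e / 6 by lra.
have [i zi] := net_down_rval_cvg dirI zl e6.
have [i' yi'] := net_down_rval_cvg dirI (net_down_compl yl) e6.
have [_ _ _ dir] := dirI; have [m im i'm] := dir i i'; exists m => j mj.
have [ymono [yub _]] := yl; have [zmono _] := zl.
have [_ _ letr _] := dirI.
have zj := le_rval (zmono _ _ (letr _ _ _ im mj)) pos1.
have yj := le_rval (ymono _ _ (letr _ _ _ i'm mj)) pos1.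
have /andP[yx xz] := yxz j.
have yl0 : 0 <= val l - val (y j) by rewrite dual_le_subr; apply: yub; exists j.
have yx0 : 0 <= val (x j) - val (y j) by rewrite dual_le_subr.
have xz1 := le_rval xz pos1.
move: yi'; rewrite /= !rvalBf.
have := opnorm_le_pos yl0; have := opnorm_le_pos yx0; rewrite !rvalBf.
have := opnormD (val (x j) - val (y j)) (val (y j) - val l).
rewrite addrA subrK [opnorm (val (y j) - _)]opnorm_distC.
move: zi zj yj xz1; rewrite /=; lra.
Qed.

Lemma norm_openP (U : set itv) :
  open U <-> forall g : itv, U g -> exists2 e, 0 < e &
    forall g' : itv, opnorm (val g' - val g) < e -> U g'.
Proof.
split=> [[B oB <-] g Bg|Uball].
  have /nbhs_ballP[e /= e0 eB] : nbhs (val g) B by apply: open_nbhs_nbhs.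
  have eE := ge0_ReK (ltW e0); rewrite eE ltcR in e0.
  exists (complex.Re e) => // g' g'g; apply: eB; rewrite -ball_normE /= eE.
  by rewrite (_ : `|_| = (opnorm (val g - val g'))%:C)// ltcR opnorm_distC.
(* A union of open balls of the dual, built so that its trace on the interval is [U]. *)
pose B := [set b : dual A | exists (g : itv) (e : R), [/\ U g, 0 < e,
  forall g' : itv, opnorm (val g' - val g) < e -> U g' & opnorm (b - val g) < e]].
exists B.
  rewrite openE => b [g [e [Ug e0 eU bg]]].
  apply/nbhs_ballP; exists (e - opnorm (b - val g))%:C; first by rewrite /= ltcR subr_gt0.
  move=> b'; rewrite -ball_normE /= (_ : `|_| = (opnorm (b - b'))%:C)// ltcR => bb'.
  exists g, e; split=> //; have := opnormD (b' - b) (b - val g).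
  rewrite addrA subrK opnorm_distC; lra.
apply/seteqP; split=> [g [g' [e [_ _ eU]]]|g Ug]; first exact: eU.
have [e e0 eU] := Uball g Ug; exists g, e; split=> //.
by rewrite subrr; have [->] := normr0 (dual A).
Qed.

Lemma norm_open_tau_o (U : set itv) : open U -> tau_o itv U.
Proof.
move=> /norm_openP oU; rewrite tau_oE => I le x l dirI xU xl Ul.
have [e e0 eU] := oU l Ul; have [i xi] := order_cvg_opnorm dirI xl e0.
by have [_ lerefl _ _] := dirI; apply: (xU i); apply/eU/xi.
Qed.

End Interval.

Arguments itv_of {R A f g}.
Arguments itv_compl {R A f}.

(** * Suprema of functionals on a commutative algebra *)

Section Inverse.
Context {R : realType} {A : cstarAlgType R}.
Implicit Types (x y a b c h k : A) (e : R).

Lemma neumann a : nrm a < 1 -> exists v, (1 - a) * v = 1 /\ v * (1 - a) = 1.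
Proof.
move=> a1; pose q := nrm a; have q0 : 0 <= q := nrm_ge0 a.
have q1 : 0 < 1 - q by rewrite subr_gt0.
pose w n := iter n (fun w : A => 1 + a * w) 0.
have wa n : a * w n = w n * a.
  by elim: n => [|n IH]; rewrite /= ?mulr0 ?mul0r// mulrDr mulrDl mulr1 mul1r {1}IH mulrA.
have wS n : nrm (w n.+1 - w n) <= q ^+ n.
  elim: n => [|n IH]; first by rewrite /w /= mulr0 addr0 subr0 nrm1_le1.
  have -> : w n.+2 - w n.+1 = a * (w n.+1 - w n).
    by rewrite mulrBr /w /= opprD addrACA subrr add0r.
  by apply: le_trans (nrmM _ _) _; rewrite exprS ler_wpM2l.
have [||l wl] := @nrm_cauchy _ _ w (fun n => (1 - q ^+ n) / (1 - q)) (1 - q)^-1.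
- move=> n; apply: le_trans (wS n) _; rewrite -mulrBl exprS ler_pdivlMr//; lra.
- move=> n; rewrite -[leRHS]mul1r ler_wpM2r ?invr_ge0 ?(ltW q1)//.
  by have := exprn_ge0 n q0; lra.
have lE : l - (1 + a * l) = 0.
  apply: (@nrm_approx0 _ _ _ 2) => e /wl[N wN].
  apply: le_trans (nrm_distD (w N.+1) _ _) _.
  have -> : w N.+1 - (1 + a * l) = a * (w N - l).
    by rewrite mulrBr /w /= opprD addrACA subrr add0r.
  rewrite nrmBC; have := wN _ (leqnSn N); have := wN _ (leqnn N).
  have := nrmM a (w N - l); have := nrm_ge0 (w N - l); rewrite -/q.
  have : q <= 1 by lra.
  by move=> qle /ler_wpM2r/(_ _ _ qle); lra.
have al : a * l - l * a = 0.
  apply: (@nrm_approx0 _ _ _ (2 * q)) => e /wl[N /(_ _ (leqnn N)) wN].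
  have -> : a * l - l * a = (w N - l) * a - a * (w N - l).
    by rewrite mulrBl mulrBr wa opprB [RHS]addrC addrA subrK.
  have := nrmB ((w N - l) * a) (a * (w N - l)).
  have := nrmM (w N - l) a; have := nrmM a (w N - l); rewrite -/q.
  by have := ler_wpM2l q0 (ltW wN); lra.
have l1 : l - a * l = 1 by rewrite {1}(subr0_eq lE) addrK.
by exists l; rewrite mulrBl mulrBr mul1r mulr1 -(subr0_eq al).
Qed.

Lemma pos_conj c x : pos c -> pos (star x * c * x).
Proof.
move=> /pos_sqrt[s [/pos_sa ss <- _]].
by rewrite mulrA -{1}ss -starM -mulrA; exact: pos_starM.
Qed.

(** Since [nrm (l - k) <= l < l + e], the Neumann series inverts [(k + e) / (l + e)]. The inverse is
    positive because [v = star v * c * v]. *)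
Lemma pos_inv k e : pos k -> 0 < e ->
  exists2 v, pos v & (k + e **: (1 : A)) * v = 1.
Proof.
move=> kp e0; have [ks [l l0 kl]] := kp; pose c := k + e **: (1 : A).
have cp : pos c by apply: posD => //; exact/pos_scalar/ltW.
have le0 : 0 < l + e by lra.
have [v [cv _]] : exists v, c * v = 1 /\ v * c = 1.
  have [|u [uc cu]] := @neumann ((l + e)^-1 **: (l **: (1 : A) - k)).
    rewrite nrmRZ ger0_norm ?invr_ge0 ?ltW// ltr_pdivrMl// mulr1.
    by apply: le_lt_trans kl _; lra.
  have cE : c = (l + e) **: (1 - (l + e)^-1 **: (l **: (1 : A) - k)).
    rewrite scalerBr scalerRA divff ?gt_eqF// scaleR1 opprB /c.
    by rewrite RCD scalerDl [RHS]addrCA [X in X - _]addrC addrK.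
  exists ((l + e)^-1 **: u); rewrite cE -!cstar_scalerAl -!cstar_scalerAr.
  by rewrite uc cu !scalerRA divff ?mulVf ?gt_eqF// scaleR1.
have vs : sa v.
  have vc : star v * c = 1 by rewrite -{1}(pos_sa cp) -starM cv star1.
  by rewrite /sa -[LHS]mulr1 -cv mulrA vc mul1r.
exists v => //; have -> : v = star v * c * v by rewrite -mulrA cv mulr1.
exact: pos_conj.
Qed.

Lemma pos_sum (I : Type) (s : seq I) (P : pred I) (F : I -> A) :
  (forall i, pos (F i)) -> pos (\sum_(i <- s | P i) F i).
Proof. by move=> Fp; apply: big_ind => //; [exact: pos0|exact: posD]. Qed.

End Inverse.

(** * The Riesz-Kantorovich supremum of a sequence of functionals *)

Section CommutativeSupremum.
Context {R : realType} {A : cstarAlgType R}.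
Hypothesis comm : forall x y : A, x * y = y * x.
Implicit Types (x y a : A).

Lemma posM x y : pos x -> pos y -> pos (x * y).
Proof.
move=> /pos_sqrt[s [/pos_sa ss <- _]] yp.
by rewrite -mulrA [s * y]comm mulrA -{1}ss; exact: pos_conj.
Qed.

Section Supremum.
Variables (h : nat -> dual A) (F : dual A) (n : nat).
Hypothesis F0 : 0 <= F.
Hypothesis hF : forall k a, pos a -> rval (h k) a <= rval F a.

Definition subpartition a (m : nat) (b : nat -> A) :=
  (forall k, pos (b k)) /\ pos (a - \sum_(n <= k < m) b k).

(** The Riesz-Kantorovich formula. Because the terms only need to sum to at most [a], the zero
    functional takes part in the supremum, which yields positive parts. *)
Definition sup_values a := [set s : R | exists m b,
  subpartition a m b /\ s = \sum_(n <= k < m) rval (h k) (b k)].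

Lemma sup_values_le G a s : 0 <= G ->
  (forall k x, (n <= k)%N -> pos x -> rval (h k) x <= rval G x) ->
  sup_values a s -> s <= rval G a.
Proof.
move=> G0 hG [m [b [[bp ab] ->]]].
have := rval_ge0 G0 ab; rewrite rvalB rval_sum subr_ge0; apply: le_trans.
rewrite big_seq [leRHS]big_seq; apply: ler_sum => k.
by rewrite mem_index_iota => /andP[nk _]; exact: hG.
Qed.

Lemma sup_values_has_sup a : pos a -> has_sup (sup_values a).
Proof.
move=> ap; split.
  exists 0, n, (fun=> 0); split; last by rewrite big_geq.
  by split=> [_|]; [exact: pos0|rewrite big_geq// subr0].
by exists (rval F a) => s; apply: sup_values_le => // k x _; exact: hF.
Qed.

Let e a := sup (sup_values a).

Let le_e a m b : pos a -> subpartition a m b ->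
  \sum_(n <= k < m) rval (h k) (b k) <= e a.
Proof.
move=> ap abm; apply: ub_le_sup; last by exists m, b.
by case: (sup_values_has_sup ap).
Qed.

Let e_le a r : pos a ->
  (forall m b, subpartition a m b -> \sum_(n <= k < m) rval (h k) (b k) <= r) -> e a <= r.
Proof.
move=> ap ar; apply: ge_sup; first by case: (sup_values_has_sup ap).
by move=> _ [m [b [abm ->]]]; exact: ar.
Qed.

Let big_widen (V : nmodType) (G : nat -> A -> V) m m' (b : nat -> A) :
  (forall k, G k 0 = 0) -> (m <= m')%N ->
  \sum_(n <= k < m') G k (if (k < m)%N then b k else 0) = \sum_(n <= k < m) G k (b k).
Proof.
move=> G0 mm'; rewrite [RHS](big_nat_widen _ _ m')// [RHS]big_mkcond /=.
by apply: eq_bigr => k _; case: ifP.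
Qed.

(** Padding by zeros brings two subpartitions to a common length, so that they can be added
    termwise. *)
Let subpartition_widen a m m' b : (m <= m')%N -> subpartition a m b ->
  exists2 b', subpartition a m' b' &
    \sum_(n <= k < m') rval (h k) (b' k) = \sum_(n <= k < m) rval (h k) (b k).
Proof.
move=> mm' [bp ab]; exists (fun k => if (k < m)%N then b k else 0); last first.
  by apply: (big_widen (G := fun k => rval (h k))) => // k; exact: rval0.
split=> [k|]; first by case: ifP => // _; exact: pos0.
by rewrite (big_widen (G := fun=> id)).
Qed.

Let e_superadd a a' : pos a -> pos a' -> e a + e a' <= e (a + a').
Proof.
move=> ap a'p; rewrite -lerBrDr; apply: e_le => // m b abm.
rewrite lerBrDr -lerBrDl; apply: e_le => // m' b' abm'; rewrite lerBrDl.
have [c [cp ac] <-] := subpartition_widen (leq_maxl m m') abm.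
have [c' [c'p ac'] <-] := subpartition_widen (leq_maxr m m') abm'.
rewrite -big_split /=; under eq_bigr do rewrite -rvalD.
apply: (le_e (b := fun k => c k + c' k)); first exact: posD.
split=> [k|]; first exact: posD.
by rewrite big_split /= opprD addrACA; exact: posD.
Qed.

(* Riesz decomposition up to [d]: a term [b k] of a subpartition of [a + a']
   splits as [a v b_k + a' v b_k + d v b_k], where [v] is the inverse of
   [a + a' + d]. *)
Let e_subadd a a' : pos a -> pos a' -> e (a + a') <= e a + e a'.
Proof.
move=> ap a'p; have aap := posD ap a'p; apply: e_le => // m b [bp ab].
have F1 := rval_ge0 F0 pos1.
suff H d : 0 < d -> \sum_(n <= k < m) rval (h k) (b k) <= e a + e a' + d * rval F 1.
  apply/ler_addgt0Pr => d d0.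
  have F2 : 0 < rval F 1 + 1 by lra.
  apply: le_trans (H _ (divr_gt0 d0 F2)) _; rewrite lerD2l mulrAC ler_pdivrMr//.
  by rewrite ler_wpM2l ?ltW//; lra.
move=> d0; have [v vp cv] := pos_inv aap d0.
have dp : pos (d **: (1 : A)) by exact/pos_scalar/ltW.
(* The remainder equals [x * v * (a + a' + d - \sum b k)], a product of positive elements. *)
have restp x : pos x -> pos (x - \sum_(n <= k < m) x * v * b k).
  move=> xp; rewrite -mulr_sumr -{1}[x]mulr1 -cv [_ * v]comm mulrA -mulrBr.
  by rewrite addrAC; apply: posM; [exact: posM|exact: posD].
have sub x : pos x -> subpartition x m (fun k => x * v * b k).
  by move=> xp; split=> [k|]; [apply: posM => //; exact: posM|exact: restp].
have bE k : b k = a * v * b k + a' * v * b k + d **: (1 : A) * v * b k.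
  by rewrite -!mulrDl cv mul1r.
under eq_bigr do rewrite bE !rvalD.
rewrite !big_split /=; apply: lerD.
  by apply: lerD; apply: le_e => //; exact: sub.
rewrite -rvalZ; apply: (@sup_values_le F _ _ F0); first by move=> k x _; exact: hF.
by exists m, (fun k => d **: (1 : A) * v * b k); split=> //; exact: sub.
Qed.

(** The last clause makes the suprema of tails small: a term [b k] of a subpartition of 1 lies
    between 0 and 1, so its norm is at most 1. *)
Lemma supremum_exists : exists E : dual A, [/\ 0 <= E,
  forall k a, (n <= k)%N -> pos a -> rval (h k) a <= rval E a,
  forall G, 0 <= G -> (forall k x, (n <= k)%N -> pos x -> rval (h k) x <= rval G x) ->
    E <= G &
  forall M, (forall m, \sum_(n <= k < m) opnorm (h k) <= M) -> rval E 1 <= M].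
Proof.
have eD a a' : pos a -> pos a' -> e (a + a') = e a + e a'.
  by move=> ap a'p; apply/eqP; rewrite eq_le e_subadd// e_superadd.
have e0 a : pos a -> 0 <= e a.
  move=> ap; have := @le_e a n (fun=> 0) ap; rewrite big_geq//; apply.
  by split=> [_|]; [exact: pos0|rewrite big_geq// subr0].
have eZ t a : 0 < t -> pos a -> t * e a <= e (t **: a).
  move=> t0 ap; rewrite -ler_pdivlMl//; apply: e_le => // m b [bp ab].
  rewrite ler_pdivlMl// mulr_sumr; under eq_bigr do rewrite -rvalZ.
  apply: (le_e (b := fun k => t **: b k)); first by apply: posZ => //; exact: ltW.
  split=> [k|]; first by apply: posZ => //; exact: ltW.
  by rewrite -scaler_sumr -scalerBr; apply: posZ => //; exact: ltW.
have [E EE] := dual_of_pos eD e0 eZ; exists E.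
have Er a : pos a -> rval E a = e a by move=> ap; rewrite /rval EE.
have E0 : 0 <= E.
  by apply/dual_leP => k kp; rewrite dual0E EE// (_ : 0 = 0%:C)// lecR e0.
split=> // [k a nk ap|G G0 hG|M hM].
(* The subpartition whose only nonzero term is [a], at index [k]. *)
- rewrite Er//; have := @le_e a k.+1 (fun j => if j == k then a else 0) ap.
  rewrite big_nat_recr//= big_nat big1 => [|j /andP[_ /ltn_eqF ->]]; last exact: rval0.
  rewrite eqxx add0r; apply; split=> [j|]; first by case: ifP => // _; exact: pos0.
  rewrite big_nat_recr//= big_nat big1 => [|j /andP[_ /ltn_eqF ->]//].
  by rewrite eqxx add0r subrr; exact: pos0.
- apply/rval_leP => // a ap; rewrite Er//; apply: e_le => // m b abm.
  by apply: (@sup_values_le G a) => //; exists m, b.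
- rewrite Er; last exact: pos1.
  apply: e_le => [|m b [bp ab]]; first exact: pos1.
  apply: le_trans (hM m); rewrite big_seq [leRHS]big_seq; apply: ler_sum => k km.
  apply: le_trans (rval_le_opnorm _ _) _; rewrite -[leRHS]mulr1.
  apply: ler_wpM2l; first exact: opnorm_ge0.
  apply: pos_le_nrm => //; rewrite scaleR1.
  move: ab; rewrite (bigD1_seq k)//= ?iota_uniq// opprD addrA => ab.
  by rewrite -(subrK (\sum_(n <= i < m | i != k) b i) (1 - b k)); apply: posD => //; exact: pos_sum.
Qed.

End Supremum.
End CommutativeSupremum.

(** * Order topology for commutative algebras *)

Section CommutativeInterval.
Context {R : realType} {A : cstarAlgType R} (f : dual A).
Hypothesis comm : forall x y : A, x * y = y * x.

Local Notation itv := (set_type (order_interval f)).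
Local Notation le_nat := (fun m n : nat => is_true (m <= n)%N).

Lemma directed_nat : directed le_nat.
Proof.
split=> [|n|m n p|m n]; [exact: (inhabits 0%N)|exact: leqnn|exact: leq_trans|].
by exists (maxn m n); [exact: leq_maxl|exact: leq_maxr].
Qed.

Lemma sum_exp2V n m : \sum_(n <= k < m) (2 ^+ k)^-1 <= 2 * (2 ^+ n)^-1 :> R.
Proof.
have p0 k : 0 < (2 ^+ k)^-1 :> R by rewrite invr_gt0 exprn_gt0.
have [nm|/ltnW mn] := leqP n m; last by rewrite big_geq// mulr_ge0// ltW.
suff -> : \sum_(n <= k < m) (2 ^+ k)^-1 = 2 * (2 ^+ n)^-1 - 2 * (2 ^+ m)^-1 :> R.
  by have := p0 m; lra.
rewrite -[RHS]opprB -(telescope_sumr (fun k => 2 * (2 ^+ k)^-1 : R) nm) -sumrN.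
apply: eq_bigr => k _; rewrite exprS; field.
by rewrite gt_eqF ?exprn_gt0.
Qed.

(** The net is [g + E n]. It stays below [f] because [f - g] dominates every [gn k - g], and its
    infimum is [g] because [E n] at 1 is at most a geometric tail. *)
Lemma upper_net_exists (g : itv) (gn : nat -> itv) :
  (forall n, opnorm (val (gn n) - val g) <= (2 ^+ n)^-1) ->
  exists z : nat -> itv, (forall n, gn n <= z n) /\ net_down le_nat z g.
Proof.
move=> gn_g; pose h k := val (gn k) - val g; pose F := f - val g.
have F0 : 0 <= F by rewrite dual_le_subr itv_le.
have hF k a : pos a -> rval (h k) a <= rval F a.
  by move=> ap; rewrite !rvalBf lerD2r; apply: le_rval => //; exact: itv_le.
have /choice[E EP] := fun n => @supremum_exists _ _ comm h F n F0 hF.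
have zge n : 0 <= val g + E n.
  by apply: dual_addr_ge0; [exact: itv_ge0|case: (EP n)].
have zle n : val g + E n <= f.
  have [_ _ Emin _] := EP n; rewrite (le_trans (dual_leD2 (lexx _) (Emin F F0 _)))//.
    by move=> k a _; exact: hF.
  by rewrite addrC subrK.
exists (fun n => itv_of (zge n) (zle n)); split=> [n|].
  have [_ Ege _ _] := EP n.
  apply/(@rval_leP _ _ (val (gn n)) (val g + E n)) => //; first exact: itv_ge0.
  by move=> k kp; have := Ege n k (leqnn n) kp; rewrite /h rvalBf rvalDf; lra.
split=> [i j ij|].
  apply: (@dual_leD2 _ _ (val g) (val g)) => //.
  have [E0 Ege _ _] := EP i; have [_ _ Emin _] := EP j.
  by apply: Emin => // k a jk; apply: Ege; exact: leq_trans ij jk.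
split=> [_ [n _ <-]|u uz].
  rewrite -[_ <= _]/(val g <= val g + E n) -{1}(addr0 (val g)) dual_leD2//.
  by case: (EP n).
apply/(@rval_leP _ _ (val u) (val g)); rewrite ?itv_ge0// => k kp.
apply/ler_addgt0Pr => d d0.
(* Gives [2 * nrm k / d < n.+1 <= 2 ^+ n]. *)
pose n := Num.truncn (2 * nrm k / d).
have En : rval (E n) 1 <= 2 * (2 ^+ n)^-1.
  have [_ _ _ Enorm] := EP n; apply: Enorm => m.
  by apply: le_trans (sum_exp2V n m); apply: ler_sum => j _; exact: gn_g.
have kn : 2 * (2 ^+ n)^-1 * nrm k <= d.
  have kd : 2 * nrm k < d * n.+1%:R by rewrite -ltr_pdivrMl// mulrC truncnS_gt.
  have n2 : n.+1%:R <= 2 ^+ n :> R by rewrite -natrX ler_nat ltn_expl.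
  rewrite mulrAC ler_pdivrMr ?exprn_gt0//.
  by have := ler_wpM2l (ltW d0) n2; lra.
have E0 : 0 <= E n by case: (EP n).
have /le_rval/(_ kp) : val u <= val g + E n by apply: (uz (itv_of (zge n) (zle n))); exists n.
rewrite rvalDf; have := rval_le_nrm E0 (pos_sa kp); rewrite ler_norml => /andP[_].
by have := ler_wpM2r (nrm_ge0 k) En; lra.
Qed.

Lemma tau_o_norm_open (U : set itv) : tau_o itv U -> open U.
Proof.
rewrite tau_oE => oU; apply/norm_openP => g Ug; apply: contrapT => nU.
have /choice[gn gnP] : forall n, exists g' : itv,
    opnorm (val g' - val g) <= (2 ^+ n)^-1 /\ ~ U g'.
  move=> n; apply: contrapT => nex; apply: nU.
  exists (2 ^+ n)^-1; first by rewrite invr_gt0 exprn_gt0.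
  by move=> g' /ltW g'g; apply: contrapT => nUg'; apply: nex; exists g'.
apply: (oU _ _ gn g directed_nat) => // [n|]; first by case: (gnP n).
have [z [gz zg]] := upper_net_exists (fun n => proj1 (gnP n)).
(* The lower net is the complement of an upper net for the functionals [f - gn n]. *)
have [|y [gy yg]] := @upper_net_exists (itv_compl g) (itv_compl \o gn).
  move=> n; have [+ _] := gnP n; rewrite opnorm_distC.
  have -> // : val (itv_compl (gn n)) - val (itv_compl g) = val g - val (gn n).
  by rewrite /= opprB addrC addrA subrK.
exists (itv_compl \o y), z; split=> // [n|].
  apply/andP; split; last exact: gz.
  by rewrite -itv_compl_le /= itv_complK; exact: gy.
by rewrite -(itv_complK g); exact: net_up_compl.
Qed.

End CommutativeInterval.

(** * Pure functionals *)

Section ExtremeMinorant.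
Context {R : realType} {A : cstarAlgType R}.
Implicit Types (x y v : A) (r t : R) (p q l m : A -> R).

Definition real_linear l :=
  (forall x y, l (x + y) = l x + l y) /\ (forall t x, l (t **: x) = t * l x).

Definition sublinear q := [/\ q 0 = 0, forall x y, q (x + y) <= q x + q y &
  forall t x, 0 < t -> q (t **: x) <= t * q x].

(* The linear minorants of [q] form a face of the set of those of [p]. *)
Definition face p q := forall l m t, real_linear l -> real_linear m ->
  (forall x, l x <= p x) -> (forall x, m x <= p x) -> 0 < t < 1 ->
  (forall x, t * l x + (1 - t) * m x <= q x) ->
  (forall x, l x <= q x) /\ (forall x, m x <= q x).

Definition facial p q := [/\ sublinear q, face p q & forall x, q x <= p x].

(* The linear minorants of [restrict q x] are the linear minorants of [q] that
   agree with [q] at [x]. *)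
Definition restrict q x v : R :=
  inf [set q (v + t **: x) - t * q x | t in [set t : R | 0 <= t]].

Lemma sublinearZ q t x : sublinear q -> 0 <= t -> q (t **: x) = t * q x.
Proof.
move=> [q0 _ qZ]; rewrite le_eqVlt => /orP[/eqP <-|t0].
  by rewrite scale0r mul0r q0.
apply/eqP; rewrite eq_le qZ//= -ler_pdivlMl//.
have tV : 0 < t^-1 by rewrite invr_gt0.
by have := qZ _ (t **: x) tV; rewrite scalerRA mulVf ?gt_eqF// scaleR1.
Qed.

Lemma sublinearN_ge q x : sublinear q -> - q (- x) <= q x.
Proof. by move=> [q0 qD _]; have := qD x (- x); rewrite subrr q0; lra. Qed.

Lemma real_linearN l x : real_linear l -> l (- x) = - l x.
Proof.
move=> [_ lZ]; have := lZ (-1) x.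
by rewrite (_ : (-1)%:C = -1 :> R[i]) ?rmorphN1// scaleN1r mulN1r.
Qed.

Lemma real_linear_le_eq l q : real_linear l -> real_linear q ->
  (forall x, l x <= q x) -> forall x, l x = q x.
Proof.
move=> ll ql lq x; apply/eqP; rewrite eq_le lq/=.
by have := lq (- x); rewrite !real_linearN// lerN2.
Qed.

Section Restrict.
Variables (q : A -> R) (x : A).
Hypothesis qs : sublinear q.

Let lb v t : 0 <= t -> - q (- v) <= q (v + t **: x) - t * q x.
Proof.
move=> t0; have [_ qD _] := qs.
have := qD (v + t **: x) (- v); rewrite addrC addKr sublinearZ//; lra.
Qed.

Lemma restrict_le v t : 0 <= t -> restrict q x v <= q (v + t **: x) - t * q x.
Proof.
move=> t0; apply: ge_inf; last by exists t.
by exists (- q (- v)) => _ [s s0 <-]; exact: lb.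
Qed.

Lemma le_restrict v r :
  (forall t, 0 <= t -> r <= q (v + t **: x) - t * q x) -> r <= restrict q x v.
Proof.
move=> rq; apply: lb_le_inf; last by move=> _ [t t0 <-]; exact: rq.
by exists (q (v + 0 **: x) - 0 * q x), 0 => /=.
Qed.

Lemma restrict_le_self v : restrict q x v <= q v.
Proof. by have := restrict_le v (lexx 0); rewrite scale0r addr0 mul0r subr0. Qed.

(** Forces a linear minorant of the restriction to be at least [q x] at [x], hence equal to it
    there. *)
Lemma restrictN_le : restrict q x (- x) <= - q x.
Proof.
have := restrict_le (- x) ler01; rewrite scaleR1 addNr mul1r.
by have [-> _ _] := qs; rewrite sub0r.
Qed.

Lemma sublinear_restrict : sublinear (restrict q x).
Proof.
have [q0 qD qZ] := qs; split.
- apply/eqP; rewrite eq_le -{1}q0 restrict_le_self.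
  by apply: le_restrict => t t0; rewrite add0r sublinearZ// subrr.
- move=> v w; rewrite -lerBlDr; apply: le_restrict => t t0.
  rewrite lerBlDr -lerBlDl; apply: le_restrict => s s0; rewrite lerBlDl.
  apply: le_trans (restrict_le _ (addr_ge0 t0 s0)) _.
  rewrite RCD scalerDl addrACA; have := qD (v + t **: x) (w + s **: x); lra.
- move=> s v s0; rewrite -ler_pdivrMl//; apply: le_restrict => t t0.
  rewrite ler_pdivrMl//; apply: le_trans (restrict_le _ (mulr_ge0 (ltW s0) t0)) _.
  by rewrite -scalerRA -scalerDr sublinearZ ?(ltW s0)//; lra.
Qed.

(** If a convex combination of [l] and [m] lies below the restriction, both lie below [q]; at [x]
    their combination reaches [q x], so both equal [q x] there, which is what being below the
    restriction requires. *)
Lemma facial_restrict p : face p q -> (forall v, q v <= p v) -> facial p (restrict q x).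
Proof.
move=> qf qp; split; [exact: sublinear_restrict| |move=> v]; last first.
  exact: le_trans (restrict_le_self v) (qp v).
move=> l m t ll ml lp mp t01 lmq; have /andP[t0 t1] := t01.
have [lq mq] := qf l m t ll ml lp mp t01 (fun v => le_trans (lmq v) (restrict_le_self v)).
have key : q x <= t * l x + (1 - t) * m x.
  by have := le_trans (lmq (- x)) restrictN_le; rewrite !real_linearN//; lra.
have t1' : 0 < 1 - t by lra.
have lx : l x = q x.
  apply/eqP; rewrite eq_le lq/= -(ler_pM2l t0).
  have := ler_wpM2l (ltW t1') (mq x); lra.
have mx : m x = q x.
  apply/eqP; rewrite eq_le mq/= -(ler_pM2l t1').
  have := ler_wpM2l (ltW t0) (lq x); lra.
split=> v; apply: le_restrict => s s0.
- by have := lq (v + s **: x); case: ll => -> ->; rewrite lx; lra.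
- by have := mq (v + s **: x); case: ml => -> ->; rewrite mx; lra.
Qed.

End Restrict.

(* A minimal facial functional agrees with all its restrictions, so it is
   linear: this is an extreme linear minorant of [p]. *)
Lemma extreme_minorant p q0 : facial p q0 ->
  exists q, [/\ facial p q, real_linear q & forall x, q x <= q0 x].
Proof.
move=> q0f; pose T := {q : A -> R | facial p q /\ forall x, q x <= q0 x}.
(* The order is reversed, so a maximal element for Zorn is a pointwise minimal functional. *)
pose le_T (s u : T) : bool := `[< forall x, sval u x <= sval s x >].
have [|||C Ctot|[q [qf qq0]] qmin] := @Zorn T le_T.
- by move=> s; apply/asboolP.
- move=> r s u /asboolP rs /asboolP su; apply/asboolP => x.
  exact: le_trans (su x) (rs x).
- move=> [s sP] [u uP] /asboolP su /asboolP us.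
  have E : s = u by apply/funext => x; apply/eqP; rewrite eq_le [s x <= _]us [u x <= _]su.
  by subst u; congr exist; exact: Prop_irrelevance.
- have [[s0 Cs0]|C0] := pselect (exists s, C s); last first.
    have q0q0 x : q0 x <= q0 x by [].
    by exists (exist _ q0 (conj q0f q0q0)) => s Cs; case: C0; exists s.
  pose S x := [set sval s x | s in C]; pose Q x := inf (S x).
  have sub (s : T) : sublinear (sval s) by case: s => s [[]].
  have Cp (s : T) x : sval s x <= p x by case: s => s [[]].
  have Cq0 (s : T) x : sval s x <= q0 x by case: s => s [].
  have Qle s x : C s -> Q x <= sval s x.
    move=> Cs; apply: ge_inf; last by exists s.
    exists (- q0 (- x)) => _ [u _ <-].
    by apply: le_trans (sublinearN_ge _ (sub u)); rewrite lerN2.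
  have leQ x r : (forall s, C s -> r <= sval s x) -> r <= Q x.
    move=> rC; apply: lb_le_inf; first by exists (sval s0 x), s0.
    by move=> _ [s Cs <-]; exact: rC.
  have Qf : facial p Q.
    split; last by move=> x; apply: le_trans (Cp s0 x); exact: Qle.
      split.
      + have s00 (s : T) : sval s 0 = 0 by case: (sub s).
        apply/eqP; rewrite eq_le -{1}(s00 s0) Qle//.
        by apply: leQ => s _; rewrite s00.
      + move=> x y; rewrite -lerBlDr; apply: (leQ _ _) => s Cs.
        rewrite lerBlDr -lerBlDl; apply: leQ => u Cu; rewrite lerBlDl.
        (* Of two functionals of the chain, the smaller one serves at both arguments. *)
        have [/asboolP su|/asboolP us] := Ctot s u Cs Cu.
        * apply: le_trans (Qle u _ Cu) _; have [_ uD _] := sub u.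
          by apply: le_trans (uD x y) _; rewrite lerD2r.
        * apply: le_trans (Qle s _ Cs) _; have [_ sD _] := sub s.
          by apply: le_trans (sD x y) _; rewrite lerD2l.
      + move=> t x t0; rewrite -ler_pdivrMl//; apply: leQ => s Cs.
        rewrite ler_pdivrMl//; have [_ _ sZ] := sub s.
        exact: le_trans (Qle s _ Cs) (sZ t x t0).
    move=> l m t ll ml lp mp t01 lmQ.
    have H s : C s -> (forall x, l x <= sval s x) /\ (forall x, m x <= sval s x).
      move=> Cs; have [_ sf _] : facial p (sval s) by case: (svalP s).
      apply: (sf l m t) => // x; apply: le_trans (lmQ x) _; exact: Qle.
    by split=> x; apply: leQ => s /H[].
  have Qq0 x : Q x <= q0 x by apply: le_trans (Cq0 s0 x); exact: Qle.
  by exists (exist _ Q (conj Qf Qq0)) => s Cs; apply/asboolP => x; exact: Qle.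
have [qs qface qp] := qf; have [q00 qD _] := qs.
have qN x : q (- x) = - q x.
  have rf := @facial_restrict _ x qs _ qface qp.
  have rq0 v : restrict q x v <= q0 v by apply: le_trans (restrict_le_self x qs v) (qq0 v).
  have /(congr1 sval)/= rE := qmin (exist _ _ (conj rf rq0))
    (asboolT (restrict_le_self x qs)).
  have := restrictN_le x qs; rewrite rE.
  by have := sublinearN_ge x qs; lra.
exists q; split=> //; split=> [x y|t x].
  have := qD x y; have := qD (- x) (- y).
  by rewrite -opprD !qN; lra.
have [t0|t0] := leP 0 t; first exact: sublinearZ.
have t0' : 0 <= - t by lra.
rewrite -[x in LHS]opprK scalerN -scaleNr -rmorphN.
by rewrite sublinearZ// qN; lra.
Qed.

End ExtremeMinorant.

(** * Existence of pure states *)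

Section PureFunctional.
Context {R : realType} {A : cstarAlgType R}.

(** For a nonzero positive [f], this says that [f] spans an extreme ray of the positive cone;
    normalization is stated apart. *)
Definition pure (f : dual A) :=
  forall g, 0 <= g -> g <= f -> exists2 s : R, 0 <= s & g = s%:C *: f.

(** Linear minorants of [nrm (re x)] with value 1 at 1 are the real parts of states. Restricting
    first at 1 and then at [z] fixes the value at 1 and makes the value at [z] at least [nrm z]; an
    extreme minorant is then a pure state. *)
Lemma pure_exists (c : A) : c != 0 ->
  exists f : dual A, [/\ 0 <= f, rval f 1 = 1, 0 < rval f (star c * c) & pure f].
Proof.
move=> c0; set z := star c * c; have zp : pos z := pos_starM c.
have cn : 0 < nrm c.
  by rewrite lt_def nrm_ge0 andbT; apply: contra c0 => /eqP/nrm_eq0/eqP.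
have n1 : nrm (1 : A) = 1.
  apply/eqP; rewrite eq_le nrm1_le1/= -(ler_pM2l cn) mulr1.
  by have := nrmM c 1; rewrite mulr1.
have zn : 0 < nrm z by rewrite nrm_starM exprn_gt0.
pose p x := nrm (re (x : A)).
have ps : sublinear p.
  split=> [|x y|t x t0]; first by rewrite /p re_id ?nrm0//; exact: sa0.
    by rewrite /p reD nrmD.
  by rewrite /p reZ nrmRZ gtr0_norm.
have re1 : p 1 = 1 by rewrite /p re_id//; exact: sa1.
have pf : facial p p by [].
pose q1 := restrict p 1; have q1f : facial p q1 by case: pf => *; exact: facial_restrict.
have [q1s q1face q1p] := q1f.
pose q2 := restrict q1 z; have q2f : facial p q2 by exact: facial_restrict.
have [q [[qs qface qp] ql qq2]] := extreme_minorant q2f; have [qD qZ] := ql.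
have q_1 : q 1 = 1.
  apply/eqP; rewrite eq_le -{1}re1 qp/=.
  have := le_trans (qq2 _) (restrict_le_self z q1s (- 1)).
  move=> /le_trans /(_ (restrictN_le 1 ps)).
  by rewrite (real_linearN _ ql) lerN2 re1.
have qz : 0 < q z.
  have : q (- z) <= - q1 z := le_trans (qq2 _) (restrictN_le z q1s).
  rewrite (real_linearN _ ql) lerN2; apply: lt_le_trans.
  apply: lt_le_trans zn _; apply: le_restrict => // t t0.
  have tz : pos (z + t **: (1 : A)) by apply: posD => //; exact: pos_scalar.
  rewrite re1 mulr1 lerBrDr /p re_id; last exact: pos_sa.
  have := pos_nrmB (pos_sa tz); set C := nrm (z + _) => Cp.
  have tC : t <= C.
    have := @pos_le_nrm _ _ (t **: (1 : A)) C (pos_scalar t0).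
    rewrite nrmRZ n1 mulr1 ger0_norm//; apply; last exact: nrm_ge0.
    by have := posD Cp zp; rewrite opprD addrAC addrA addrK.
  rewrite -lerBrDr; apply: pos_le_nrm => //; last by rewrite subr_ge0.
  by rewrite RCB scalerBl -addrA -opprD [_ + z]addrC.
have q_ge0 k : pos k -> 0 <= q k.
  move=> [ks [l l0 kl]].
  have := qp (l **: (1 : A) - k); rewrite qD qZ q_1 (real_linearN _ ql) /p re_id.
    by move=> /le_trans/(_ kl); lra.
  by apply: saB => //; exact: sa_scalar.
have [|||f fE] := @dual_of_pos _ A q.
- by move=> h k _ _; exact: qD.
- exact: q_ge0.
- by move=> t h _ _; rewrite qZ.
have f0 : 0 <= f.
  by apply/dual_leP => k kp; rewrite dual0E fE// (_ : 0 = 0%:C)// lecR q_ge0.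
have fpos k : pos k -> rval f k = q k by move=> kp; rewrite /rval fE.
have fq x : rval f x = q x.
  rewrite rval_re// [in RHS](reIm x) qD; have hs := re_sa x.
  have -> : q ('i%C *: im x) = 0.
    (* [p] vanishes at [i y] for self-adjoint [y], so [q] is nonpositive at [i y] and at [- i y]. *)
    have iN y : sa y -> q ('i%C *: y) <= 0.
      move=> ys; apply: le_trans (qp _) _.
      by have := re_comb sa0 ys; rewrite add0r /p => ->; rewrite nrm0.
    apply/eqP; rewrite eq_le (iN _ (im_sa x))/=.
    have := iN _ (saN (im_sa x)); rewrite scalerN (real_linearN _ ql); lra.
  move: (re x) hs => h hs; rewrite addr0.
  have -> : h = (nrm h **: (1 : A) + h) - nrm h **: (1 : A) by rewrite addrC addKr.
  rewrite rvalB qD (real_linearN _ ql) !fpos//; first exact/pos_scalar/nrm_ge0.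
  exact: pos_nrmD.
exists f; split=> //; [by rewrite fq|by rewrite fq|].
move=> g g0 gf; pose t := rval g 1; have t0 : 0 <= t := rval_ge0 g0 pos1.
have t1 : t <= 1 by rewrite -q_1 -fq; exact: le_rval gf pos1.
exists t => //; have [tE|tn0] := eqVneq t 0.
  by rewrite tE scale0r; exact: pos_eq0.
have [tE|tn1] := eqVneq t 1.
  have -> : t%:C *: f = f by rewrite tE; exact: scale1r.
  apply/esym/subr0_eq; apply: pos_eq0.
    by rewrite dual_le_subr.
  by rewrite rvalBf fq q_1 -/t tE subrr.
have {tn0}tp : 0 < t by rewrite lt_def tn0.
have {tn1}t'p : 0 < 1 - t by rewrite subr_gt0 lt_def eq_sym tn1.
have rl (k : dual A) (s : R) : real_linear (fun x => s * rval k x).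
  by split=> [x y|r x]; rewrite ?rvalD ?rvalZ; ring.
have rle (k : dual A) : 0 <= k -> 0 < rval k 1 ->
    forall x, (rval k 1)^-1 * rval k x <= p x.
  move=> k0 k1 x; rewrite ler_pdivrMl// rval_re//.
  by apply: le_trans (ler_norm _) _; apply: rval_le_nrm => //; exact: re_sa.
have fg0 : 0 <= f - g by rewrite dual_le_subr.
have fg1 : rval (f - g) 1 = 1 - t by rewrite rvalBf fq q_1.
have fg1p : 0 < rval (f - g) 1 by rewrite fg1.
(* [f] is the convex combination of the normalized [g] and [f - g] with weights [t] and [1 - t]. *)
have := qface _ _ t (rl g t^-1) (rl (f - g) (rval (f - g) 1)^-1) (rle _ g0 tp) (rle _ fg0 fg1p).
move=> [|x|gq _]; first by rewrite tp/= -subr_gt0.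
  rewrite fg1 !mulrA !divff ?gt_eqF// !mul1r rvalBf fq; lra.
apply: rval_eq => //; first exact: dual_scale_ge0.
move=> k _; rewrite rvalZf fq -(real_linear_le_eq (rl g t^-1) ql gq).
by rewrite mulrA divff ?gt_eqF// mul1r.
Qed.

End PureFunctional.

(** * Noncommutative algebras *)

Section Compression.
Context {R : realType} {A : cstarAlgType R}.
Implicit Types (x y u v b k : A) (f g : dual A).

Lemma compression_exists f u : exists g, forall x, g x = f (star u * x * u).
Proof.
apply: (@dual_of_bounded _ _ _ (opnorm f * (nrm u * nrm u))) => [a x y|x].
  by rewrite mulrDr mulrDl dualD -cstar_scalerAr -cstar_scalerAl dualZ.
apply: le_trans (normc_le_opnorm _ _) _; rewrite -[leRHS]mulrA.
apply: ler_wpM2l; first exact: opnorm_ge0.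
apply: le_trans (nrmM _ _) _; rewrite mulrAC; apply: ler_wpM2r; first exact: nrm_ge0.
by apply: le_trans (nrmM _ _) _; rewrite nrm_star.
Qed.

Definition compression f u : dual A := projT1 (cid (compression_exists f u)).

Lemma compressionE f u x : compression f u x = f (star u * x * u).
Proof. exact: (projT2 (cid (compression_exists f u))). Qed.

Lemma rval_compression f u x : rval (compression f u) x = rval f (star u * x * u).
Proof. by rewrite /rval compressionE. Qed.

Lemma compression_ge0 f u : 0 <= f -> 0 <= compression f u.
Proof.
move=> /dual_leP f0; apply/dual_leP => k kp; rewrite compressionE.
by apply: f0; exact: pos_conj.
Qed.

Lemma mulr_conjD u v x : star (u + v) * x * (u + v) =
  (star u * x * u + star v * x * v) + (star u * x * v + star v * x * u).
Proof. by rewrite starD !mulrDl !mulrDr [star v * x * u + _]addrC addrACA. Qed.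

(** Parallelogram identity: the two sides differ by the compression by [u - v], which is
    positive. *)
Lemma compression_le f u v : 0 <= f ->
  compression f (u + v) <= 2%:C *: (compression f u + compression f v).
Proof.
move=> f0; have fu := compression_ge0 u f0; have fv := compression_ge0 v f0.
apply/rval_leP; first exact: compression_ge0.
  by apply: dual_scale_ge0 => //; exact: dual_addr_ge0.
move=> k kp; have := rval_ge0 (compression_ge0 (u - v) f0) kp.
rewrite rvalZf rvalDf !rval_compression !mulr_conjD !rvalD starN !mulrN !mulNr opprK !rvalN.
lra.
Qed.

Lemma compression_dist f u : opnorm (compression f (1 + u) - f) <=
  opnorm f * (2 * nrm u + nrm u ^+ 2).
Proof.
apply: opnorm_le => x; rewrite nrmE => x1; have {}x1 : nrm x <= 1 by rewrite -lecR.
have -> : (compression f (1 + u) - f) x = f (star u * x * u + (x * u + star u * x)).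
  rewrite -[LHS]/(compression f (1 + u) x - f x) compressionE mulr_conjD.
  by rewrite star1 !mul1r !mulr1 -addrA dualD [LHS]addrC addKr.
apply: le_trans (normc_le_opnorm _ _) _; apply: ler_wpM2l; first exact: opnorm_ge0.
have u0 := nrm_ge0 u.
have xu : nrm (x * u) <= nrm u.
  by apply: le_trans (nrmM _ _) _; rewrite -[leRHS]mul1r ler_wpM2r.
have ux : nrm (star u * x) <= nrm u.
  by apply: le_trans (nrmM _ _) _; rewrite nrm_star -[leRHS]mulr1 ler_wpM2l.
have uxu : nrm (star u * x * u) <= nrm u ^+ 2.
  by apply: le_trans (nrmM _ _) _; rewrite expr2 ler_wpM2r.
have := nrmD (star u * x * u) (x * u + star u * x).
have := nrmD (x * u) (star u * x); lra.
Qed.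

(** With [g = s f], conjugating [g <= compression f u] by the inverse [v] gives
    [s f (star v * . * v) <= f], so by purity the left side is [r f]. Evaluation at [star u * b * u]
    gives [r = 0], and evaluation at [star u * u] then gives [s = 0]. *)
Lemma pure_compression_disjoint f u v b g : 0 <= f -> pure f -> rval f 1 = 1 ->
  u * v = 1 -> v * u = 1 -> f b = 0 -> compression f u b <> 0 ->
  0 <= g -> g <= f -> g <= compression f u -> g = 0.
Proof.
move=> f0 fpure f1 uv vu fb fub g0 gf gfu; have [s s0 gE] := fpure g g0 gf.
have svu : star v * star u = 1 by rewrite -starM uv star1.
have suv : star u * star v = 1 by rewrite -starM vu star1.
have vuK x : star v * (star u * x * u) * v = x.
  by rewrite !mulrA svu mul1r -mulrA uv mulr1.
have uvK x : star u * (star v * x * v) * u = x.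
  by rewrite !mulrA suv mul1r -mulrA vu mulr1.
pose h := s%:C *: compression f v.
have h0 : 0 <= h by apply: dual_scale_ge0 => //; exact: compression_ge0.
have hf : h <= f.
  apply/rval_leP => // k kp; rewrite rvalZf rval_compression.
  have := le_rval gfu (pos_conj v kp).
  by rewrite gE rvalZf rval_compression uvK.
have [r r0 hE] := fpure h h0 hf.
have r_0 : r = 0.
  have : h (star u * b * u) = 0 by rewrite dualZE compressionE vuK fb mulr0.
  rewrite hE dualZE -compressionE => /eqP; rewrite mulf_eq0 => /orP[/eqP[]//|/eqP //].
have : rval h (star u * (1 : A) * u) = 0 by rewrite hE r_0 rvalZf mul0r.
rewrite rvalZf rval_compression vuK f1 mulr1 => s_0.
by rewrite gE s_0 scale0r.
Qed.

End Compression.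

(** * Nonmultiplicative pure states and the failure of the equality of topologies *)

Section NonCommutative.
Context {R : realType} {A : cstarAlgType R}.
Implicit Types (x y b : A).

Lemma multiplicative_of_null (f : dual A) : 0 <= f -> f 1 = 1 ->
  (forall b, f b = 0 -> f (star b * b) = 0) -> forall x y, f (x * y) = f x * f y.
Proof.
move=> f0 f1 fnull x y; pose b := y - f y *: (1 : A).
have fb : f b = 0 by rewrite dualB dualZ f1 mulr1 subrr.
have := pos_null_ideal x f0 (fnull b fb).
rewrite mulrBr -cstar_scalerAr mulr1 dualB dualZ => /subr0_eq ->.
by rewrite mulrC.
Qed.

(** A multiplicative functional kills the commutator [c], so a pure state positive at [star c * c]
    is not multiplicative. The last sum is the first-order coefficient in [t] of the perturbed state
    at [b]; if it vanishes, replacing [b] by [i b] turns it into [2 f (star b * b)]. *)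
Lemma pure_nonmultiplicative x y : x * y <> y * x -> exists (f : dual A) b,
  [/\ 0 <= f, pure f, rval f 1 = 1, f b = 0 & f (b * b) + f (star b * b) != 0].
Proof.
move=> xy; have c0 : x * y - y * x != 0 by rewrite subr_eq0; apply/eqP.
have [f [f0 f1 fc fpure]] := pure_exists c0.
have f1C : f 1 = 1 by rewrite (pos_rval f0 pos1) f1.
have [b [fb fbb]] : exists b, f b = 0 /\ f (star b * b) != 0.
  apply: contrapT => nb.
  have fnull b : f b = 0 -> f (star b * b) = 0.
    by move=> fb; apply: contrapT => /eqP fbb; apply: nb; exists b.
  have fM := multiplicative_of_null f0 f1C fnull.
  move: fc; rewrite /rval fM [f (_ - _)]dualB !fM [f y * _]mulrC subrr mulr0.
  by rewrite ltxx.
have [bb0|bb0] := eqVneq (f (b * b) + f (star b * b)) 0; last by exists f, b.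
exists f, ('i%C *: b); split=> //; first by rewrite dualZ fb mulr0.
rewrite starIZ mulNr -!cstar_scalerAl -!cstar_scalerAr !scaleII opprK dualN.
move/eqP: bb0; rewrite addr_eq0 => /eqP ->; rewrite opprK -mulr2n.
by rewrite mulrn_eq0.
Qed.

Lemma interval_not_norm_topology x y : x * y <> y * x ->
  exists f : dual A, [/\ positive_functional f, f <> 0 &
    @open (order_interval f) <> tau_o (order_interval f)].
Proof.
move=> /pure_nonmultiplicative[p [b [p0 ppure p1 pb]]].
set al := p (b * b) + p (star b * b) => al0.
pose ga := p (star b * b * b).
have an : 0 < Normc.normc al.
  rewrite lt_def; apply/andP; split; last by case: (al) => ? ?; exact: sqrtr_ge0.
  by apply: contra al0 => /eqP/Normc.eq0_normc/eqP.
have gn : 0 <= Normc.normc ga by case: (ga) => ? ?; exact: sqrtr_ge0.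
have bn := nrm_ge0 b.
(* Makes [t n] small enough both for [1 + t n b] to be invertible and for [t n * ga] to be smaller
   than [al] in modulus. *)
pose be := nrm b + Normc.normc ga / Normc.normc al.
have be0 : 0 <= be by rewrite addr_ge0// divr_ge0// ltW.
pose t n : R := (n.+1%:R * (1 + be))^-1.
have t0 n : 0 < t n by rewrite invr_gt0 mulr_gt0//; lra.
have tbe n : t n * (1 + be) <= 1.
  rewrite /t invfM -mulrA mulVf ?mulr1; last by rewrite gt_eqF//; lra.
  by rewrite invf_le1// ler1n.
have t1 n : t n <= 1 by have := tbe n; have := t0 n; nra.
have tn n : t n <= n.+1%:R^-1.
  by rewrite /t invfM -[leRHS]mulr1 ler_wpM2l ?invr_ge0// invf_le1 //; lra.
have tb n : nrm (- (t n **: b)) < 1.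
  rewrite nrmN nrmRZ gtr0_norm//; have := tbe n; rewrite /be.
  have : 0 <= t n * (Normc.normc ga / Normc.normc al).
    by apply: mulr_ge0; [exact: ltW|apply: divr_ge0 => //; exact: ltW].
  have := t0 n; lra.
have tga n : t n * Normc.normc ga < Normc.normc al.
  rewrite -[ltRHS]mul1r -ltr_pdivrMr// -mulrA; have := tbe n; rewrite /be.
  have : 0 <= t n * nrm b by rewrite mulr_ge0// ltW.
  have := t0 n; lra.
pose u n := 1 + t n **: b; pose pn n := compression p (u n).
have pnb n : pn n b <> 0.
  have -> : pn n b = (t n)%:C * (al + (t n)%:C * ga).
    rewrite compressionE mulr_conjD star1 starRZ !mul1r mulr1.
    rewrite -!cstar_scalerAl -!cstar_scalerAr !dualD !dualZ pb add0r mulr1.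
    by rewrite -!mulrDr addrC.
  move=> /eqP; rewrite mulf_eq0 => /orP[/eqP[tn0]|].
    by have := t0 n; rewrite tn0 ltxx.
  rewrite addr_eq0 => /eqP/(congr1 (@Normc.normc R)).
  rewrite normcN Normc.normcM normcR gtr0_norm// => E.
  by have := tga n; rewrite E ltxx.
have inv n : exists v, u n * v = 1 /\ v * u n = 1.
  by have := neumann (tb n); rewrite opprK.
pose f := 2%:C *: (compression p 1 + compression p b).
have cp1 : compression p 1 = p by apply: dualP => z; rewrite compressionE star1 mul1r mulr1.
have pf : p <= f.
  apply/rval_leP => //.
    by apply: dual_scale_ge0 => //; apply: dual_addr_ge0; exact: compression_ge0.
  move=> k kp; rewrite rvalZf rvalDf cp1.
  have := rval_ge0 p0 kp; have := rval_ge0 (compression_ge0 b p0) kp; lra.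
have f0 : 0 <= f := le_trans p0 pf.
have pn0 n : 0 <= pn n := compression_ge0 _ p0.
have pnf n : pn n <= f.
  apply: le_trans (compression_le _ _ p0) _.
  apply/rval_leP => //.
    by apply: dual_scale_ge0 => //; apply: dual_addr_ge0; exact: compression_ge0.
  move=> k kp; rewrite !rvalZf !rvalDf ler_wpM2l// lerD2l !rval_compression starRZ.
  rewrite -!cstar_scalerAl -!cstar_scalerAr scalerRA rvalZ.
  have := rval_ge0 (compression_ge0 b p0) kp; rewrite rval_compression.
  have := t0 n; have := t1 n => t1n t0n bk.
  by rewrite -[leRHS]mul1r ler_wpM2r//; nra.
exists f; split; first exact/dual_ge0P.
  by move=> fz; have := le_rval pf pos1; rewrite fz p1 rvalf0 ler10.
move=> openE.
pose X := range (fun n => itv_of (pn0 n) (pnf n)).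
pose pI := itv_of p0 pf.
have pn_p e : 0 < e -> exists N, forall n, (N <= n)%N -> opnorm (pn n - p) < e.
  move=> e0; pose K := opnorm p * (2 * nrm b + nrm b ^+ 2).
  have K0 : 0 <= K by rewrite mulr_ge0 ?opnorm_ge0// addr_ge0 ?sqr_ge0// mulr_ge0.
  exists (Num.truncn (K / e)) => n Nn.
  have : K < e * n.+1%:R.
    rewrite -ltr_pdivrMl// mulrC; apply: lt_le_trans (truncnS_gt _) _.
    by rewrite ler_nat.
  rewrite -ltr_pdivrMr ?ltr0n// => Kn; apply: le_lt_trans Kn.
  apply: le_trans (compression_dist _ _) _.
  rewrite -[leRHS]mulrA ler_wpM2l ?opnorm_ge0// nrmRZ gtr0_norm//.
  have b2 := sqr_ge0 (nrm b); have si : 0 <= n.+1%:R^-1 - t n by rewrite subr_ge0.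
  have s1 : 0 <= 1 - t n by rewrite subr_ge0.
  have := mulr_ge0 si bn; have := mulr_ge0 si b2.
  have := mulr_ge0 (ltW (t0 n)) (mulr_ge0 s1 b2); rewrite exprMn [t n ^+ 2]expr2.
  move: (nrm b ^+ 2) (n.+1%:R^-1) => B i; lra.
have oX : tau_o (order_interval f) (~` X).
  rewrite tau_oE /= setCK => I le xs l dirI xsX xl; apply: contrapT => nXl.
  have [lp|lp] := eqVneq (val l) p.
    (* Each term of the lower net is below [p] and below some [pn n], hence 0. So 0 bounds the lower
       net, and its supremum [p] would be at most 0. *)
    have [ys [zs [yxz [_ [yub ylub]] _]]] := xl.
    have ys0 i : val (ys i) = 0.
      have [n _ xE] := xsX i; have [v [uv vu]] := inv n.
      apply: (pure_compression_disjoint p0 ppure p1 uv vu pb (pnb n)).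
      - exact: itv_ge0.
      - by rewrite -lp; apply: yub; exists i.
      - by have /andP[+ _] := yxz i; rewrite -xE.
    have l0 : l <= itv_of (lexx 0) f0.
      by apply: ylub => _ [i _ <-]; rewrite -[_ <= _]/(val (ys i) <= 0) ys0.
    by have := le_rval l0 pos1; rewrite lp p1 /= rvalf0 ler10.
  have d0 : 0 < opnorm (val l - p).
    rewrite lt_def opnorm_ge0 andbT; apply: contra lp => /eqP/opnorm_eq0/subr0_eq/eqP.
    exact.
  have d2 : 0 < opnorm (val l - p) / 2 by lra.
  have [N pnN] := pn_p _ d2.
  (* From [N] on, [pn n] is close to [p], hence far from [l]. The finitely many earlier ones differ
     from [l], so they keep a positive distance from it. *)
  have [e e0 eN] : exists2 e : R, 0 < e & forall n, (n < N)%N -> e <= opnorm (pn n - val l).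
    elim: {pnN} N => [|N [e e0 eN]]; first by exists 1.
    have pl : 0 < opnorm (pn N - val l).
      rewrite lt_def opnorm_ge0 andbT; apply/eqP => /opnorm_eq0/subr0_eq pnl.
      by apply: nXl; exists N => //; apply: val_inj.
    exists (Num.min e (opnorm (pn N - val l))); first by rewrite lt_min e0.
    move=> n; rewrite ltnS leq_eqVlt => /orP[/eqP ->|/eN ne]; first by rewrite ge_min lexx orbT.
    by rewrite ge_min ne.
  pose e' := Num.min e (opnorm (val l - p) / 2).
  have e'0 : 0 < e' by rewrite lt_min e0.
  have [i0 xi] := order_cvg_opnorm dirI xl e'0.
  have [_ lerefl _ _] := dirI; have := xi i0 (lerefl i0).
  have [n _ <-] := xsX i0; rewrite lt_min => /andP[/= ne nd].
  have [/eN|/pnN] := ltnP n N; first lra.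
  have := opnormD (val l - pn n) (pn n - p).
  rewrite addrA subrK [opnorm (val l - pn n)]opnorm_distC; lra.
(* [X] is not norm closed: [p] is a norm limit of its points but lies outside, since [p b = 0] while
   [pn n b] is nonzero. *)
have : @open (order_interval f) (~` X) by rewrite openE.
move=> /norm_openP/(_ pI)[|e e0 eX].
  by move=> [n _ /(congr1 val) pE]; apply: (pnb n); rewrite -pb -[p in RHS]pE.
have [N pnN] := pn_p _ e0.
by apply: (eX (itv_of (pn0 N) (pnf N))); [exact: pnN|exists N].
Qed.

End NonCommutative.

Theorem corollary9 (R : realType) (A : cstarAlgType R) :
  (forall x y : A, x * y = y * x) <->
  (forall f : dual A, positive_functional f -> f <> 0 ->
     @open (order_interval f) = tau_o (order_interval f)).
Proof.
split=> [comm f _ _|topE x y].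
  apply/seteqP; split=> U; first exact: norm_open_tau_o.
  exact: tau_o_norm_open.
apply: contrapT => /interval_not_norm_topology[f [f0 fn0]]; apply.
exact: topE.
Qed.
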